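(* Let $A_\Gamma$ be a right-angled Artin group and let $H\le A_\Gamma$ be a finitely generated subgroup. Then the relative growth rate of $H$ exists with respect to every finite generating set of $A_\Gamma$; that is, for every finite generating set $X$ of $A_\Gamma$ the limit $\lim_{n\to\infty}\sqrt[n]{\beta_H^X(n)}$ exists.
   Context: For a finite graph $\Gamma$ with vertex set $V$ and edge set $E$, the right-angled Artin group is $A_\Gamma=\langle V \mid [u,v]=1 \text{ if } \{u,v\}\in E\rangle$. For a group $G$ with finite generating set $X$, $|g|_X$ denotes word length with respect to $X\cup X^{-1}$. For a subgroup $H\le G$ and $n\in\mathbb{N}$, $B_H^X(n)=\{h\in H : |h|_X\le n\}$ and $\beta_H^X(n)=|B_H^X(n)|$. The relative (exponential) growth rate of $H$ with respect to $X$ is said to exist if $\lim_{n\to\infty}\sqrt[n]{\beta_H^X(n)}$ exists. *)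

(* Defs.v *)
From HB Require Import structures.
From Stdlib Require Import Relation_Operators.
From mathcomp Require Import all_boot all_order all_algebra finmap generic_quotient.
From mathcomp Require Import all_classical all_reals all_analysis.

Set Implicit Arguments.
Unset Strict Implicit.
Unset Printing Implicit Defensive.

Import Order.TTheory GRing.Theory Num.Theory numFieldNormedType.Exports.

Local Open Scope classical_set_scope.
Local Open Scope quotient_scope.
Local Open Scope group_scope.

(* The letter (x, false) stands for x and (x, true) for x^-1. *)
Definition word (V : Type) : Type := seq (V * bool).

Definition inv_word (V : Type) (w : word V) : word V :=
  rev [seq (a.1, ~~ a.2) | a <- w].

Section Presentation.
Variables (V : choiceType) (rels : set (word V)).

Inductive pres_step : word V -> word V -> Prop :=
| pres_cancel (p q : word V) (x : V) (b : bool) :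
    pres_step (p ++ [:: (x, b); (x, ~~ b)] ++ q) (p ++ q)
| pres_relator (p q r : word V) :
    rels r -> pres_step (p ++ r ++ q) (p ++ q).

Definition pres_eq : word V -> word V -> Prop :=
  clos_refl_sym_trans (word V) pres_step.

Definition pres_eqb (u v : seq (V * bool)) : bool := `[< pres_eq u v >].

Lemma pres_eqb_refl : reflexive pres_eqb.
Proof. by move=> u; apply/asboolP; apply: rst_refl. Qed.

Lemma pres_eqb_sym : symmetric pres_eqb.
Proof. by move=> u v; apply/asboolP/asboolP; apply: rst_sym. Qed.

Lemma pres_eqb_trans : transitive pres_eqb.
Proof.
by move=> v u w /asboolP uv /asboolP vw; apply/asboolP; apply: rst_trans uv vw.
Qed.

Canonical pres_equiv : equiv_rel (seq (V * bool)) :=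
  EquivRel pres_eqb pres_eqb_refl pres_eqb_sym pres_eqb_trans.

Lemma pres_eq_refl (u : word V) : pres_eq u u.
Proof. exact: rst_refl. Qed.

Lemma pres_eq_sym (u v : word V) : pres_eq u v -> pres_eq v u.
Proof. exact: rst_sym. Qed.

Lemma pres_eq_trans (v u w : word V) :
  pres_eq u v -> pres_eq v w -> pres_eq u w.
Proof. exact: rst_trans. Qed.

Lemma pres_eq_ctx (p q u v : word V) :
  pres_eq u v -> pres_eq (p ++ u ++ q) (p ++ v ++ q).
Proof.
elim=> {u v} [u v [a b x c|a b r rr]|u|u v _|u v w _ ? _].
- have := pres_cancel (p ++ a) (b ++ q) x c; rewrite -!catA.
  exact: rst_step.
- have := pres_relator (p ++ a) (b ++ q) rr; rewrite -!catA.
  exact: rst_step.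
- exact: pres_eq_refl.
- exact: pres_eq_sym.
- exact: pres_eq_trans.
Qed.

Lemma pres_eq_cat (u u' v v' : word V) :
  pres_eq u u' -> pres_eq v v' -> pres_eq (u ++ v) (u' ++ v').
Proof.
move=> /(@pres_eq_ctx [::] v) /= uu' /(@pres_eq_ctx u' [::]).
by rewrite !cats0; apply: pres_eq_trans.
Qed.

Lemma inv_word_cat (u v : word V) :
  inv_word (u ++ v) = inv_word v ++ inv_word u.
Proof. by rewrite /inv_word map_cat rev_cat. Qed.

Lemma inv_wordK : involutive (@inv_word V).
Proof.
move=> w; rewrite /inv_word map_rev revK -map_comp map_id_in // => -[x b] _ /=.
by rewrite negbK.
Qed.

Lemma pres_eq_mulV (w : word V) : pres_eq (w ++ inv_word w) [::].
Proof.
elim: w => [|[x b] w IH]; first exact: pres_eq_refl.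
rewrite -cat1s inv_word_cat -catA (catA w).
apply: pres_eq_trans (pres_eq_ctx _ _ IH) _.
exact/rst_step/(@pres_cancel [::] [::]).
Qed.

Lemma pres_eq_inv (u v : word V) :
  pres_eq u v -> pres_eq (inv_word u) (inv_word v).
Proof.
move=> uv.
have h1 : pres_eq (inv_word u) (inv_word u ++ v ++ inv_word v).
  rewrite -[X in pres_eq X _]cats0; apply: pres_eq_cat; first exact: pres_eq_refl.
  exact/pres_eq_sym/pres_eq_mulV.
apply: pres_eq_trans h1 _; rewrite catA -[X in pres_eq _ X]cat0s.
apply: pres_eq_cat; last exact: pres_eq_refl.
apply: pres_eq_trans (pres_eq_cat (pres_eq_refl _) (pres_eq_sym uv)) _.
by rewrite -{2}(inv_wordK u); apply: pres_eq_mulV.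
Qed.

(* The group < V | rels >. *)
Definition pres_group : Type := {eq_quot pres_equiv}.
HB.instance Definition _ := Choice.on pres_group.
HB.instance Definition _ := EqQuotient.on pres_group.

Definition pres_class (w : word V) : pres_group := \pi_pres_group w.

Lemma pres_classP (u v : word V) :
  pres_class u = pres_class v <-> pres_eq u v.
Proof.
by split=> [/eqP|uv]; [rewrite eqmodE => /asboolP|apply/eqP; rewrite eqmodE; apply/asboolP].
Qed.

Lemma pres_class_repr (x : pres_group) : pres_class (repr x) = x.
Proof. exact: reprK. Qed.

Definition pres_one : pres_group := pres_class [::].
Definition pres_mul (x y : pres_group) : pres_group :=
  pres_class (repr x ++ repr y).
Definition pres_inv (x : pres_group) : pres_group :=
  pres_class (inv_word (repr x)).

Lemma pres_class_mul (u v : word V) :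
  pres_mul (pres_class u) (pres_class v) = pres_class (u ++ v).
Proof. by apply/pres_classP/pres_eq_cat; apply/pres_classP/pres_class_repr. Qed.

Lemma pres_class_inv (u : word V) :
  pres_inv (pres_class u) = pres_class (inv_word u).
Proof. by apply/pres_classP/pres_eq_inv; apply/pres_classP/pres_class_repr. Qed.

Lemma pres_mulA : associative pres_mul.
Proof.
move=> x y z; rewrite -(pres_class_repr x) -(pres_class_repr y).
by rewrite -(pres_class_repr z) !pres_class_mul catA.
Qed.

Lemma pres_mul1 : left_id pres_one pres_mul.
Proof. by move=> x; rewrite -(pres_class_repr x) pres_class_mul. Qed.

Lemma pres_mulr1 : right_id pres_one pres_mul.
Proof. by move=> x; rewrite -(pres_class_repr x) pres_class_mul cats0. Qed.

Lemma pres_mulrV : right_inverse pres_one pres_inv pres_mul.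
Proof.
move=> x; rewrite -(pres_class_repr x) pres_class_inv pres_class_mul.
exact/pres_classP/pres_eq_mulV.
Qed.

Lemma pres_mulVr : left_inverse pres_one pres_inv pres_mul.
Proof.
move=> x; rewrite -(pres_class_repr x) pres_class_inv pres_class_mul.
by apply/pres_classP; rewrite -{2}(inv_wordK (repr x)); apply: pres_eq_mulV.
Qed.

HB.instance Definition _ := isGroup.Build pres_group
  pres_mulA pres_mul1 pres_mulr1 pres_mulVr pres_mulrV.

End Presentation.

Record sgraph := SGraph {
  vertex :> finType;
  adj : rel vertex;
  adj_sym : symmetric adj;
  adj_irr : irreflexive adj
}.

(* The word u^-1 v^-1 u v, matching [~ u, v]. *)
Definition comm_word (V : Type) (u v : V) : word V :=
  [:: (u, true); (v, true); (u, false); (v, false)].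

Definition raag_rels (Gamma : sgraph) : set (word Gamma) :=
  [set r | exists u v : Gamma, adj u v /\ r = comm_word u v].

Definition raag (Gamma : sgraph) : Type := pres_group (@raag_rels Gamma).
HB.instance Definition _ (Gamma : sgraph) := Group.on (raag Gamma).

Section Growth.
Variable G : groupType.

Definition is_subgroup (H : set G) : Prop := group_closed [in H].

Definition generated (A : set G) : set G := smallest is_subgroup A.

Definition finitely_generated (H : set G) : Prop :=
  exists Y : {fset G}, H = generated [set` Y].

Definition generating (X : {fset G}) : Prop := generated [set` X] = setT.

Definition product_of_length (X : {fset G}) (g : G) (n : nat) : Prop :=
  exists w : seq G, [/\ size w = n,
    {in w, forall x, x \in X \/ x^-1 \in X} & \prod_(x <- w) x = g].

(* The value is meaningful when g is in the subgroup generated by X; it is 0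
   otherwise. *)
Definition word_length (X : {fset G}) (g : G) : nat :=
  match pselect (exists n, `[< product_of_length X g n >]) with
  | left e => ex_minn e
  | right _ => 0
  end.

Definition rel_ball (X : {fset G}) (H : set G) (n : nat) : set G :=
  [set h | H h /\ word_length X h <= n].

(* [fset_set] is only meaningful on finite sets: see [finite_rel_ball]. *)
Definition rel_growth (X : {fset G}) (H : set G) (n : nat) : nat :=
  #|` fset_set (rel_ball X H n)|.

(* The 0th term, which is irrelevant to the limit, is beta(0) `^ 0 = 1. *)
Definition rel_growth_rate_exists (R : realType) (X : {fset G}) (H : set G) :
    Prop :=
  cvgn (fun n : nat => ((rel_growth X H n)%:R `^ n%:R^-1 : R)%R).

Lemma subgroup_products (X : {fset G}) :
  is_subgroup [set g | exists n, product_of_length X g n].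
Proof.
split=> [|g h]; first by rewrite inE; exists 0, [::]; split; rewrite // big_nil.
rewrite !inE => -[_ [u [_ uX <-]]] [_ [v [_ vX <-]]].
exists (size (u ++ rev [seq x^-1 | x <- v])), (u ++ rev [seq x^-1 | x <- v]); split=> // [x|].
  rewrite mem_cat mem_rev => /orP[/uX//|/mapP[y /vX yX ->]].
  by rewrite invgK; case: yX; [right|left].
rewrite big_cat /=; congr (_ * _) => {vX}.
elim: v => [|x v IH]; first by rewrite !big_nil invg1.
by rewrite /= rev_cons -cats1 big_cat /= IH big_seq1 big_cons invgM.
Qed.

Lemma word_length_exists (X : {fset G}) (g : G) :
  generating X -> product_of_length X g (word_length X g).
Proof.
move=> genX; rewrite /word_length; case: pselect => [e|[]].
  by case: ex_minnP => n /asboolP.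
suff [n gn] : exists n, product_of_length X g n by exists n; apply/asboolP.
have : generated [set` X] g by rewrite genX.
move/(_ [set h | exists n, product_of_length X h n]); apply.
split; first exact: subgroup_products.
move=> x /= xX; exists 1%N, [:: x]; split=> // [y|]; last by rewrite big_seq1.
by rewrite inE => /eqP ->; left.
Qed.

Lemma word_length_min (X : {fset G}) (g : G) (n : nat) :
  product_of_length X g n -> word_length X g <= n.
Proof.
move=> gn; rewrite /word_length; case: pselect => // e.
by case: ex_minnP => m _; apply; apply/asboolP.
Qed.

Lemma finite_rel_ball (X : {fset G}) (H : set G) (n : nat) :
  generating X -> finite_set (rel_ball X H n).
Proof.
move=> genX; pose S : seq G := X ++ [seq x^-1 | x <- X].
have fin m : finite_set [set g | product_of_length X g m].
  elim: m => [|m IH].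
    apply: (@sub_finite_set _ _ [set 1]); last exact: finite_set1.
    by move=> g [w [/size0nil -> _ <-]] /=; rewrite big_nil.
  apply: (@sub_finite_set _ _
    [set x * y | x in [set` S] & y in [set g | product_of_length X g m]]).
    move=> g [[|x w] [// [sw] wX <-]]; rewrite big_cons.
    exists x.
      rewrite /= /S mem_cat; have [->//|xX] := wX x (mem_head _ _).
      by apply/orP; right; apply/mapP; exists x^-1; rewrite ?invgK.
    exists (\prod_(y <- w) y) => //=; exists w; split=> // y yw.
    by apply: wX; rewrite inE yw orbT.
  by apply: finite_image2 IH; apply: finite_seq.
apply: (@sub_finite_set _ _
  (\bigcup_(m in `I_n.+1) [set g | product_of_length X g m])).
  by move=> g [_ gn]; exists (word_length X g) => //; apply: word_length_exists.
by apply: bigcup_finite => [|m _]; [exact: finite_II|exact: fin].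
Qed.

End Growth.

(* Main.v *)
Require Import Defs.
From Stdlib Require Import Relation_Operators.
From mathcomp Require Import all_boot all_order all_algebra finmap.
From mathcomp Require Import all_classical all_reals all_analysis.
From mathcomp Require Import zify ring lra.

(** The idea. A right-angled Artin group acts on one tree for each vertex v of
    its graph, the distance from the base point to its translate by g being the
    number ell v g of v-letters in a reduced word of g. The sum of these
    distances is the word length, so an element is determined, up to finitely
    many choices, by its position, up to a bounded error, in all the trees.

    Growth rates exist as soon as the sizes b n of the balls of H satisfy
    b n * b m <= P n * b (n + m + c) with P a polynomial and c a constant
    (growth_rate_exists, a form of Fekete's lemma). To obtain this, map a pair
    (g, h) to u = g * f * h, with f in H chosen in a finite set F. If in each
    tree f is long and cancels little against g and h, then g lies near the
    segment from 1 to u, and its position there is given by the number ell v g.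
    So for given u and f there are only polynomially many g, and g determines h.

    It remains to find F (separation). After conjugating H so as to minimize
    the displacement of its generators, H fixes the base point of each tree
    on which it has no loxodromic element (conj_reduction); finite generation
    serves here. On the other trees a single t in H is loxodromic
    (simultaneous_loxodromic). In a tree where the stabilizer in H of an end of
    t has finite index, H stays near finitely many rays, and again ell v g and
    finitely many labels locate g (finite_index_tame). In all the remaining
    trees at once, B.H. Neumann's lemma (avoid_cosets) provides many conjugates
    of powers of t which point in different directions; for each pair (g, h),
    each tree and each side at most one of them fails, so that one of them
    serves as f (ping_pong).

    The last dichotomy requires that an element of H fixing one end of t in a
    tree fixes the other one (fixed_end_opposite), which is false for general
    trees and rests on the relation between the trees of non-adjacent vertices
    (tree_length_pair) and on the commutation between adjacent ones. *)

Set Implicit Arguments.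
Unset Strict Implicit.
Unset Printing Implicit Defensive.

Import Order.TTheory GRing.Theory Num.Theory numFieldNormedType.Exports.

Local Open Scope classical_set_scope.
Local Open Scope group_scope.

(** * Length functions of actions on trees *)

Section TreeLength.
Variable G : groupType.
Implicit Types (l : G -> nat) (g h x y t : G).

(** Twice the Gromov product of g and h at the base point. *)
Definition overlap l g h : nat := l g + l h - l (g^-1 * h).

(** A Lyndon length function: the displacement of a base point under an action
    on a tree. The tree enters only through the last axiom, which says that
    segments issued from the base point branch as in a tree. *)
Record tree_length l : Prop := TreeLength {
  tree_length1 : l 1 = 0;
  tree_lengthV : forall g, l g^-1 = l g;
  tree_lengthM : forall g h, l (g * h) <= l g + l h;
  overlap_ultra : forall g h (k : G),
    minn (overlap l g k) (overlap l k h) <= overlap l g h }.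

(** In a tree this means that t has a positive translation length; otherwise
    its powers stay bounded (length_ellX). *)
Definition loxodromic l t := l t < l (t * t).

(** Both sequences tend to the same end of the tree. *)
Definition same_end l (a b : nat -> G) := forall K, exists n0,
  forall n m, n0 <= n -> n0 <= m -> K <= overlap l (a n) (b m).

(** All that is used of a ray: its points go to infinity and, of two of them,
    the nearer one is close to the segment from 1 to the farther one. *)
Definition quasi_ray l (a : nat -> G) :=
  (exists C, forall n m, 2 * minn (l (a n)) (l (a m)) <= overlap l (a n) (a m) + C)
  /\ (forall K, exists n0, forall n, n0 <= n -> K <= l (a n)).

Definition ray x t (n : nat) : G := x * t ^+ n.

End TreeLength.

(** lia compares atoms syntactically, whereas the same product of group
    elements may occur with its law taken from different structures on G; this
    identifies the convertible values of l before calling lia. *)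
Ltac merge_atoms l :=
  let rec merge_lengths _ := (lazymatch goal with
    | |- context [l ?x] =>
      let a := fresh "a" in set (a := l x);
      repeat match goal with
      | |- context [l ?y] => unify x y; change (l y) with a
      end; clearbody a; merge_lengths tt
    | _ => idtac end) in
  let rec merge_overlaps _ := (lazymatch goal with
    | |- context [overlap l ?x ?y] =>
      let a := fresh "a" in set (a := overlap l x y);
      repeat match goal with
      | |- context [overlap l ?u ?v] =>
        unify x u; unify y v; change (overlap l u v) with a
      end; clearbody a; merge_overlaps tt
    | _ => idtac end) in
  merge_overlaps tt; merge_lengths tt.

Ltac tree_lia l :=
  repeat match goal with H : ?P |- _ =>
    lazymatch type of P with Prop =>
      match P with context [l] => revert H end end end;
  merge_atoms l; intros; lia.

Section OneTree.
Variables (G : groupType) (l : G -> nat).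
Implicit Types (g h x y t : G).
Hypothesis lT : tree_length l.
Local Notation ov := (overlap l).

Lemma overlapE g h : ov g h + l (g^-1 * h) = l g + l h.
Proof.
rewrite /overlap subnK //; apply: leq_trans (tree_lengthM lT _ _) _.
by rewrite (tree_lengthV lT).
Qed.

Lemma overlapC g h : ov g h = ov h g.
Proof. by rewrite /overlap -(tree_lengthV lT (h^-1 * g)) invgM invgK addnC. Qed.

Lemma length_triangle g h : l g <= l h + l (h^-1 * g).
Proof. by have := tree_lengthM lT h (h^-1 * g); rewrite mulVKg. Qed.

Lemma length_triangleV g h : l g <= l h + l (g^-1 * h).
Proof.
have := length_triangle g h.
by rewrite -(tree_lengthV lT (h^-1 * g)) invgM invgK.
Qed.

Lemma overlap_le g h : ov g h <= 2 * l g.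
Proof. by have := overlapE g h; have := length_triangle h g; tree_lia l. Qed.

Lemma overlap_ultra3 g (k k' : G) h B :
  B <= ov g k -> B <= ov k k' -> B <= ov k' h -> B <= ov g h.
Proof.
move=> gk kk' k'h; have := overlap_ultra lT g k' k.
have := overlap_ultra lT g h k'; tree_lia l.
Qed.

Lemma overlap_mulr g h x : ov (g * x) h <= ov g h + 2 * l x.
Proof.
have := overlapE (g * x) h; rewrite invgM -(mulgA x^-1); have := overlapE g h.
have := tree_lengthM lT g x; have := length_triangle (g^-1 * h) x.
tree_lia l.
Qed.

Lemma overlap_mull g h x : ov g h <= ov (x * g) (x * h) + 2 * l x.
Proof.
have := overlapE (x * g) (x * h); rewrite invgM -(mulgA g^-1) mulKg.
have := overlapE g h.
have := length_triangle g x^-1; have := length_triangle h x^-1.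
by rewrite invgK (tree_lengthV lT) //; tree_lia l.
Qed.

Lemma overlap_mulr_ge g h x : ov g h <= ov (g * x) h + 2 * l x.
Proof. by have := overlap_mulr (g * x) h x^-1; rewrite mulgK (tree_lengthV lT). Qed.

Lemma loxodromicV t : loxodromic l t^-1 = loxodromic l t.
Proof. by rewrite /loxodromic -invgM !(tree_lengthV lT). Qed.

Definition translation t := l (t * t) - l t.
(** Twice the distance from the base point to the axis of t. *)
Definition axis_gap t := 2 * l t - l (t * t).

Lemma translation_gt0 t : loxodromic l t -> 0 < translation t.
Proof. by rewrite /translation subn_gt0. Qed.

Lemma length_sqr t : l (t * t) <= 2 * l t.
Proof. by have := tree_lengthM lT t t; tree_lia l. Qed.

(** The path from 1 to t ^+ n goes to the axis of t, follows it for n periods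
    and comes back. *)
Lemma length_loxX t n : loxodromic l t ->
  l (t ^+ n.+1) = (n.+1 * translation t + axis_gap t)%N.
Proof.
move=> tl; have t2 := length_sqr t; have tau0 := translation_gt0 tl.
have [n2] := ubnP n; elim: n2 n => // n2 IH [|[|n]] le_n.
- by rewrite expg1 /translation /axis_gap; move: tl; rewrite /loxodromic; tree_lia l.
- by rewrite expg2 /translation /axis_gap; move: tl; rewrite /loxodromic; tree_lia l.
have I1 := IH n.+1 ltac:(lia); have I0 := IH n ltac:(lia).
have Il : l t = (translation t + axis_gap t)%N.
  by rewrite /translation /axis_gap; move: tl; rewrite /loxodromic; tree_lia l.
have E1 := overlapE t (t ^+ n.+2); rewrite expgS mulKg in E1.
have E0 := overlapE t^-1 t; rewrite invgK (tree_lengthV lT) // in E0.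
have E2 := overlapE t^-1 (t ^+ n.+2); rewrite invgK -expgS (tree_lengthV lT) // in E2.
have U1 := overlap_ultra lT t^-1 (t ^+ n.+2) t.
have U2 := overlap_ultra lT t^-1 t (t ^+ n.+2).
rewrite (overlapC _ t) in U2.
rewrite -expgS in E1.
have tau : l (t * t) = (2 * translation t + axis_gap t)%N.
  by rewrite /translation /axis_gap; move: tl; rewrite /loxodromic; tree_lia l.
tree_lia l.
Qed.

Lemma length_ellX t n : ~~ loxodromic l t -> l (t ^+ n) <= l t.
Proof.
rewrite /loxodromic -leqNgt => tl.
have [n2] := ubnP n; elim: n2 n => // n2 IH [|[|n]] le_n.
- by rewrite expg0 tree_length1.
- by rewrite expg1.
have I1 := IH n.+1 ltac:(lia); have I0 := IH n ltac:(lia).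
have E1 := overlapE t (t ^+ n.+1); rewrite [in l (_ * _)]expgS mulKg in E1.
have E0 := overlapE t^-1 t; rewrite invgK (tree_lengthV lT) // in E0.
have E2 := overlapE t^-1 (t ^+ n.+1); rewrite invgK -expgS (tree_lengthV lT) // in E2.
have U1 := overlap_ultra lT t^-1 (t ^+ n.+1) t.
tree_lia l.
Qed.

Lemma length_loxX_ge t n : loxodromic l t -> n <= l (t ^+ n).
Proof.
move=> tl; case: n => // n; rewrite length_loxX //.
by have := translation_gt0 tl; nia.
Qed.

Lemma axis_gapV t : axis_gap t^-1 = axis_gap t.
Proof. by rewrite /axis_gap -invgM !(tree_lengthV lT). Qed.

Lemma overlap_loxX t n m : loxodromic l t ->
  2 * minn (l (t ^+ n)) (l (t ^+ m)) <= ov (t ^+ n) (t ^+ m) + axis_gap t.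
Proof.
move=> tl; wlog le_nm : n m / n <= m => [H|].
  by case: (leqP n m) => [/H //|/ltnW /H]; rewrite minnC overlapC.
have := overlapE (t ^+ n) (t ^+ m).
rewrite -(subnKC le_nm) expgnDr mulKg -expgnDr.
case: n le_nm => [|n] le_nm; first by rewrite expg0 (tree_length1 lT) //; tree_lia l.
rewrite addSn !length_loxX //.
case: (m - n.+1) => [|d]; first by rewrite expg0 (tree_length1 lT) //; tree_lia l.
by rewrite !length_loxX //; tree_lia l.
Qed.

Lemma overlap_loxVX t n m : loxodromic l t ->
  ov (t^-1 ^+ n) (t ^+ m) <= axis_gap t.
Proof.
move=> tl; have lV := tree_lengthV lT (t ^+ n).
have := overlapE (t^-1 ^+ n) (t ^+ m); rewrite !expVgn invgK -expgnDr.
case: n lV => [|n] lV; first by rewrite add0n expg0 invg1 (tree_length1 lT) //; tree_lia l.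
have ln := length_loxX n tl; case: m => [|m].
  by rewrite addn0 expg0 (tree_length1 lT) //; tree_lia l.
have := length_loxX m tl; have := length_loxX (n + m.+1) tl.
by rewrite -addSn; tree_lia l.
Qed.

Lemma quasi_ray_ray x t : loxodromic l t -> quasi_ray l (ray x t).
Proof.
move=> tl; split.
  exists (axis_gap t + 4 * l x)%N => n m.
  have := overlap_loxX n m tl; have := overlap_mull (t ^+ n) (t ^+ m) x.
  have := tree_lengthM lT x (t ^+ n); have := tree_lengthM lT x (t ^+ m).
  by rewrite /ray; tree_lia l.
move=> K; exists (K + l x) => n le_n; have := length_loxX_ge n tl.
have := length_triangle (t ^+ n) x^-1; rewrite invgK (tree_lengthV lT) // /ray.
by tree_lia l.
Qed.

Lemma same_end_sym a b : same_end l a b -> same_end l b a.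
Proof. by move=> ab K; have [n0 H] := ab K; exists n0 => n m *; rewrite overlapC H. Qed.

Lemma same_end_trans b a c : same_end l a b -> same_end l b c -> same_end l a c.
Proof.
move=> ab bc K; have [n0 H0] := ab K; have [n1 H1] := bc K.
exists (n0 + n1) => n m le_n le_m.
have := overlap_ultra lT (a n) (c m) (b (n0 + n1)).
have := H0 n (n0 + n1) ltac:(lia) ltac:(lia).
have := H1 (n0 + n1) m ltac:(lia) ltac:(lia); tree_lia l.
Qed.

Lemma same_end_mull x a b : same_end l a b ->
  same_end l (fun n => x * a n) (fun n => x * b n).
Proof.
move=> ab K; have [n0 H0] := ab (K + 2 * l x)%N; exists n0 => n m le_n le_m.
have := overlap_mull (a n) (b m) x; have := H0 n m le_n le_m; tree_lia l.
Qed.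

Lemma same_end_ext a a' b b' : a =1 a' -> b =1 b' ->
  same_end l a b -> same_end l a' b'.
Proof. by move=> aa bb ab K; have [n0 H] := ab K; exists n0 => n m *; rewrite -aa -bb H. Qed.

Lemma same_end_ray_mull x y z t u :
  same_end l (ray y t) (ray z u) -> same_end l (ray (x * y) t) (ray (x * z) u).
Proof.
by move/(same_end_mull x); apply: same_end_ext => n; rewrite /ray mulgA.
Qed.

(** Two rays in a tree either share an end or part at a bounded distance. *)
Lemma quasi_ray_unbounded a b : quasi_ray l a -> quasi_ray l b ->
  (forall K, exists n m, K <= ov (a n) (b m)) -> same_end l a b.
Proof.
move=> [[Ca rA] gA] [[Cb rB] gB] unb K.
have [n0 N0] := gA (K + Ca + Cb)%N; have [m0 M0] := gB (K + Ca + Cb)%N.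
have [n1 [m1 le1]] := unb (2 * (K + Ca + Cb))%N.
exists (n0 + m0) => n m le_n le_m.
have la := overlap_le (a n1) (b m1); have lb := overlap_le (b m1) (a n1).
rewrite overlapC in lb.
have Rn := rA n n1; have Rm := rB m1 m.
have Nn := N0 n ltac:(lia); have Mm := M0 m ltac:(lia).
by apply: (@overlap_ultra3 _ (a n1) (b m1)); lia.
Qed.

Lemma ray_dichotomy x y t u : loxodromic l t -> loxodromic l u ->
  ~ same_end l (ray x t) (ray y u) ->
  exists B, forall n m, ov (ray x t n) (ray y u m) <= B.
Proof.
move=> tl ul ncv; apply: contrapT => /forallNP unb; apply: ncv.
apply: quasi_ray_unbounded; do ?exact: quasi_ray_ray.
move=> K; have /existsNP[n /existsNP[m /negP]] := unb K.
by rewrite -ltnNge => /ltnW ?; exists n, m.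
Qed.

Lemma axis_ends_distinct t : loxodromic l t -> ~ same_end l (ray 1 t) (ray 1 t^-1).
Proof.
move=> tl /(_ (axis_gap t).+1)[n0 /(_ n0 n0 (leqnn _) (leqnn _))].
by rewrite /ray !mul1g overlapC; have := overlap_loxVX n0 n0 tl; tree_lia l.
Qed.

Lemma same_end_ray_refl x t : loxodromic l t -> same_end l (ray x t) (ray x t).
Proof.
move=> tl; have q := quasi_ray_ray x tl; apply: (quasi_ray_unbounded q q) => K.
have [_ /(_ K)[n H]] := q; exists n, n; rewrite /overlap mulVg (tree_length1 lT) //.
by have := H n (leqnn _); tree_lia l.
Qed.

(** If x does not map the attracting end of t to its repelling end, then
    x * t ^+ n is loxodromic: its square does not fold back. *)
Lemma loxodromic_mulX x t : loxodromic l t ->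
  ~ same_end l (ray x t) (ray 1 t^-1) ->
  exists n0, forall n, n0 <= n -> loxodromic l (x * t ^+ n).
Proof.
move=> tl; have tl' : loxodromic l t^-1 by rewrite loxodromicV.
move=> /(ray_dichotomy tl tl')[B HB].
exists (B + 4 * l x).+1%N => n le_n; have := HB n n; rewrite /ray mul1g.
rewrite expVgn overlapC => Bn.
set y := x * t ^+ n in Bn *.
have E := overlapE y^-1 y; rewrite invgK (tree_lengthV lT) // in E.
rewrite /loxodromic.
have ly : l (t ^+ n) <= l x + l y.
  by have := length_triangle (t ^+ n) x^-1; rewrite invgK (tree_lengthV lT).
have lt := length_loxX_ge n tl.
suff : ov y^-1 y <= B by tree_lia l.
have U := overlap_ultra lT (t ^- n) y y^-1.
have M := overlap_mulr_ge (t ^- n) (t ^- n) x^-1.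
have E2 := overlapE (t ^- n) (t ^- n).
rewrite mulVg (tree_length1 lT) // !(tree_lengthV lT) // in E2.
have yV : y^-1 = t ^- n * x^-1 by rewrite /y invgM.
rewrite -yV (tree_lengthV lT) // overlapC in M.
tree_lia l.
Qed.

(** By loxodromic_mulX it is enough that b ^+ m does not map the attracting end
    of t to its repelling end. If some b ^+ k fixes the repelling end, so do
    all its powers; if none does, at most one power of b maps the attracting
    end there, because two such powers would differ by one that fixes it. *)
Lemma loxodromic_XmulX (b t : G) : loxodromic l t ->
  exists k M, 0 < k /\ forall m, M <= m -> k %| m ->
    exists n0, forall n, n0 <= n -> loxodromic l (b ^+ m * t ^+ n).
Proof.
move=> tl.
pose flip m := same_end l (ray (b ^+ m) t) (ray 1 t^-1).
suff [k [M [k0 H]]] : exists k M, 0 < k /\ forall m, M <= m -> k %| m -> ~ flip m.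
  by exists k, M; split=> // m le_m km; apply: loxodromic_mulX (H m le_m km).
have tl' : loxodromic l t^-1 by rewrite loxodromicV.
case: (pselect (exists2 k, 0 < k & same_end l (ray (b ^+ k) t^-1) (ray 1 t^-1))).
  move=> [k k0 fk]; exists k, 0; split=> // _ _ /dvdnP[q ->] fq.
  have fix_q : same_end l (ray (b ^+ (q * k)) t^-1) (ray 1 t^-1).
    elim: q {fq} => [|q IH]; first exact: same_end_ray_refl.
    rewrite mulSn addnC expgnDr.
    apply: same_end_trans IH; have := same_end_ray_mull (b ^+ (q * k)) fk.
    by rewrite mulg1.
  apply: (axis_ends_distinct tl).
  have := same_end_ray_mull (b ^+ (q * k))^-1
    (same_end_trans fq (same_end_sym fix_q)).
  by rewrite !mulVg.
move=> nofix; case: (pselect (exists m, flip m)) => [[m1 f1]|nf]; last first.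
  by exists 1%N, 0; split=> // m _ _ fm; apply: nf; exists m.
exists 1%N, m1.+1; split=> // m lt_m _ fm; apply: nofix.
exists (m - m1); first by rewrite subn_gt0.
have := same_end_ray_mull (b ^+ (m - m1)) f1; rewrite -expgnDr subnK 1?ltnW //.
rewrite mulg1 => /same_end_sym H; apply: same_end_sym.
by apply: same_end_trans (same_end_sym fm) _; apply: same_end_sym.
Qed.

(** The product b ^+ m * t ^+ n folds back only if t ^- n sends a long initial
    part of the segment to b ^- m onto that of the segment to b ^+ m. If both n
    and 2 * n did so, t ^- n would roughly fix the first one, and the two
    segments would agree for longer than the axis of b allows. *)
Lemma loxodromic_Xmul_ell (b t : G) : loxodromic l b -> ~~ loxodromic l t ->
  exists M, forall m n, M <= m ->
    loxodromic l (b ^+ m * t ^+ n) \/ loxodromic l (b ^+ m * t ^+ (2 * n)).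
Proof.
move=> bl te; exists (3 * l t).+1 => m n le_m.
case: m le_m => // m le_m; have lb := length_loxX m bl.
have tau0 := translation_gt0 bl.
set d := b ^+ m.+1 in lb *.
have fold k : ~~ loxodromic l (d * t ^+ k) -> l d - l t <= ov (t ^- k * d^-1) d.
  rewrite /loxodromic -leqNgt -invgM; set y := d * _ => ne.
  have E := overlapE y^-1 y; rewrite invgK (tree_lengthV lT) // in E.
  have lk := length_ellX k te.
  have ly : l d <= l y + l t.
    by have := length_triangleV d y; rewrite /y mulKg; tree_lia l.
  have U := overlap_ultra lT y^-1 d y.
  have M := overlap_mulr_ge d d (t ^+ k).
  have E2 := overlapE d d; rewrite mulVg (tree_length1 lT) // in E2.
  rewrite -/y in M; tree_lia l.
case: (boolP (loxodromic l (d * t ^+ n))) => [|/fold F1]; first by left.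
case: (boolP (loxodromic l (d * t ^+ (2 * n)))) => [|/fold F2]; first by right.
exfalso.
have U := overlap_ultra lT (t ^- n * d^-1) (t ^- (2 * n) * d^-1) d.
rewrite [ov d _]overlapC in U.
have M := overlap_mull (t ^- n * d^-1) (t ^- (2 * n) * d^-1) (t ^+ n).
rewrite mulVKg mulgA in M.
have e : t ^+ n * t ^- (2 * n) = t ^- n.
  by rewrite mul2n -addnn expgnDr invgM mulVKg.
rewrite e in M.
have U2 := overlap_ultra lT d^-1 d (t ^- n * d^-1).
have gap := overlap_loxVX m.+1 m.+1 bl; rewrite expVgn -/d in gap.
have tau_le : m.+1 <= m.+1 * translation b by rewrite leq_pmulr.
have := length_ellX n te; tree_lia l.
Qed.

End OneTree.

Section Simultaneous.
Variables (G : groupType) (I : finType) (l : I -> G -> nat).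
Hypothesis lT : forall i, tree_length (l i).
Variable H : G -> Prop.
Hypotheses (H1 : H 1) (HM : forall x y, H x -> H y -> H (x * y)).

Lemma closed_expg x n : H x -> H (x ^+ n).
Proof. by move=> Hx; elim: n => // n IH; rewrite expgS; apply: HM. Qed.

(** Let t be loxodromic on the trees treated so far and elliptic on the next
    one, where b is loxodromic. Then b ^+ m * t ^+ n is loxodromic on the former
    trees for suitable m and all large n, and on the new one for n or 2 * n. *)
Lemma simultaneous_loxodromic (s : seq I) :
  (forall i, i \in s -> exists2 b, H b & loxodromic (l i) b) ->
  exists2 t, H t & forall i, i \in s -> loxodromic (l i) t.
Proof.
elim: s => [|w s IH] ex; first by exists 1.
have [|t Ht tl] := IH; first by move=> i si; apply: ex; rewrite inE si orbT.
have [b Hb bl] := ex w (mem_head _ _).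
case: (boolP (loxodromic (l w) t)) => [tw|tw].
  by exists t => // i; rewrite inE => /predU1P[->//|/tl].
have [M0 HM0] := loxodromic_Xmul_ell (lT w) bl tw.
have [m [le_m [n0 Hn0]]] : exists m, M0 <= m /\ exists n0, forall n, n0 <= n ->
    forall i, i \in s -> loxodromic (l i) (b ^+ m * t ^+ n).
  have [k [M [k0 Hk]]] : exists k M, 0 < k /\ forall m, M <= m -> k %| m ->
      exists n0, forall n, n0 <= n ->
      forall i, i \in s -> loxodromic (l i) (b ^+ m * t ^+ n).
    elim: s tl {IH ex} => [|i s IH] tl; first by exists 1%N, 0; split=> // m _ _; exists 0.
    have [k [M [k0 Hk]]] := IH (fun j js => tl j ltac:(by rewrite inE js orbT)).
    have [k' [M' [k0' Hk']]] := loxodromic_XmulX (lT i) b (tl i (mem_head _ _)).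
    exists (k * k')%N, (M + M'); split; first by rewrite muln_gt0 k0.
    move=> m le_m km.
    have [n1 Hn1] := Hk m ltac:(lia) (dvdn_trans (dvdn_mulr _ (dvdnn _)) km).
    have [n2 Hn2] := Hk' m ltac:(lia) (dvdn_trans (dvdn_mull _ (dvdnn _)) km).
    exists (n1 + n2) => n le_n j; rewrite inE => /predU1P[->|js].
      by apply: Hn2; lia.
    by apply: Hn1 js; lia.
  exists ((M0 + M) * k)%N; split; first by nia.
  by apply: Hk; [nia|exact: dvdn_mull].
case: (HM0 m n0 le_m) => lox.
  exists (b ^+ m * t ^+ n0); first by apply: HM; apply: closed_expg.
  by move=> i; rewrite inE => /predU1P[->//|]; apply: Hn0.
exists (b ^+ m * t ^+ (2 * n0)); first by apply: HM; apply: closed_expg.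
by move=> i; rewrite inE => /predU1P[->//|]; apply: Hn0; lia.
Qed.

End Simultaneous.

Section FixedPoints.
Variable (G : groupType) (l : G -> nat).
Hypothesis lT : tree_length l.
Implicit Types (g h x y t : G).
Local Notation ov := (overlap l).

(** If h fixes the attracting end of t, the rays from 1 and from h along t share
    an end, so they stay within a bounded distance of each other. *)
Lemma same_end_conj_bound h t : loxodromic l t ->
  same_end l (ray h t) (ray 1 t) ->
  forall n, l (t ^- n * h * t ^+ n) <= axis_gap l t + 3 * l h.
Proof.
move=> tl cv n; have [N0 HN0] := cv (2 * l (t ^+ n))%N.
pose N := N0 + n + l (t ^+ n).
have := HN0 N N ltac:(lia) ltac:(lia); rewrite /ray mul1g => O1.
have O2 := overlap_loxX lT n N tl.
have O3 := overlap_mull lT (t ^+ N) (t ^+ n) h.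
have LN := length_loxX_ge lT N tl.
have U := overlap_ultra3 lT (g := t ^+ n) (k := t ^+ N) (k' := h * t ^+ N)
  (h := h * t ^+ n) (B := 2 * l (t ^+ n) - axis_gap l t - 2 * l h).
have E := overlapE lT (t ^+ n) (h * t ^+ n); rewrite mulgA in E.
have M := tree_lengthM lT h (t ^+ n).
rewrite [ov (h * _) (t ^+ _)](overlapC lT) in O1.
rewrite [ov (t ^+ N) (t ^+ n)](overlapC lT) in O3.
have {}U : 2 * l (t ^+ n) - axis_gap l t - 2 * l h <= ov (t ^+ n) (h * t ^+ n).
  by apply: U; try (rewrite /N in O1 O2 O3 LN *; lia).
tree_lia l.
Qed.

(** Multiplying by e moves both rays of the axis of t along themselves, so e
    lies near the axis, hence near one of the two rays. *)
Lemma near_axis e t : loxodromic l t ->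
  same_end l (ray e t) (ray 1 t) -> same_end l (ray e t^-1) (ray 1 t^-1) ->
  exists (b : bool) N0, forall N, N0 <= N ->
    2 * l e <= ov e ((if b then t else t^-1) ^+ N) + axis_gap l t.
Proof.
move=> tl cp cm; have tl' : loxodromic l t^-1 by rewrite (loxodromicV lT).
have cp' : same_end l (ray e^-1 t) (ray 1 t).
  apply: same_end_sym => //; have := same_end_ray_mull lT e^-1 cp.
  by rewrite mulVg mulg1.
have cm' : same_end l (ray e^-1 t^-1) (ray 1 t^-1).
  apply: same_end_sym => //; have := same_end_ray_mull lT e^-1 cm.
  by rewrite mulVg mulg1.
have [n1 H1] := cp' (axis_gap l t).+1; have [n2 H2] := cm' (axis_gap l t).+1.
pose N := (n1 + n2 + l e).+1.
have := H1 N N ltac:(lia) ltac:(lia); rewrite /ray mul1g => O1.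
have := H2 N N ltac:(lia) ltac:(lia); rewrite /ray mul1g => O2.
have O3 := overlap_loxVX lT N N tl.
have O4 : ov (e^-1 * t ^+ N) (e^-1 * t^-1 ^+ N) <= axis_gap l t.
  rewrite leqNgt; apply/negP => lt.
  have := overlap_ultra3 lT (g := t ^+ N) (h := t^-1 ^+ N) (B := (axis_gap l t).+1) _ lt O2.
  by rewrite (overlapC lT (t ^+ N)) => /(_ O1); rewrite (overlapC lT); lia.
have E1 := overlapE lT e (t ^+ N); have E2 := overlapE lT e (t^-1 ^+ N).
have E3 := overlapE lT (e^-1 * t ^+ N) (e^-1 * t^-1 ^+ N).
have lx : l ((e^-1 * t ^+ N)^-1 * (e^-1 * t^-1 ^+ N)) = l (t ^+ (N + N)).
  rewrite invgM invgK -mulgA mulVKg -expVgn -expgnDr expVgn.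
  by rewrite (tree_lengthV lT).
rewrite lx in E3.
have LV : l (t^-1 ^+ N) = l (t ^+ N) by rewrite expVgn (tree_lengthV lT).
have L1 := length_loxX lT (N + N).-1 tl; have L2 := length_loxX lT N.-1 tl.
have LN := length_loxX_ge lT N tl.
have NN : (N + N).-1.+1 = N + N by rewrite /N; lia.
rewrite NN in L1; rewrite prednK // in L2.
have U := overlap_ultra lT (t^-1 ^+ N) (t ^+ N) e.
rewrite (overlapC lT _ e) in U.
have S : 2 * l e <= ov e (t ^+ N) + ov e (t^-1 ^+ N) by tree_lia l.
have [b Hb] : exists b : bool,
    2 * l e <= ov e ((if b then t else t^-1) ^+ N) + axis_gap l t.
  by case: (leqP (ov e (t ^+ N)) (axis_gap l t)) => le;
    [exists false|exists true]; tree_lia l.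
exists b, N => M le_M; set u := if b then _ else _ in Hb *.
have ul : loxodromic l u by rewrite /u; case: (b).
have gu : axis_gap l u = axis_gap l t by rewrite /u; case: (b); rewrite ?(axis_gapV lT).
have O5 := overlap_loxX lT N M ul; rewrite gu in O5.
have LuN := length_loxX_ge lT N ul; have LuM := length_loxX_ge lT M ul.
have U5 := overlap_ultra lT e (u ^+ M) (u ^+ N).
have le_eN : l e <= N by rewrite /N; lia.
lia.
Qed.

(** Two elements near one ray are as close as their distances to the base point
    are: position on a ray is given by length. *)
Lemma near_same_ray e e' u C N :
  2 * l e <= ov e (u ^+ N) + C -> 2 * l e' <= ov e' (u ^+ N) + C ->
  l (e^-1 * e') <= C + (l e - l e') + (l e' - l e).
Proof.
move=> H H'; have E := overlapE lT e e'.
have := overlap_ultra lT e e' (u ^+ N); rewrite (overlapC lT _ e').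
lia.
Qed.

(** A long middle factor f that cancels little on either side keeps g near
    the segment from 1 to g * f * h. *)
Lemma overlap_concat g f h C : ov g^-1 f <= C -> ov f^-1 h <= C -> C < l f ->
  2 * l g <= ov g (g * f * h) + C.
Proof.
move=> gf fh lf; rewrite -mulgA; set y := f * h.
have E1 := overlapE lT f y; rewrite mulKg in E1.
have E2 := overlapE lT f^-1 h; rewrite invgK (tree_lengthV lT) -/y in E2.
have U := overlap_ultra lT g^-1 f y; rewrite (overlapC lT y) in U.
have E3 := overlapE lT g^-1 y; rewrite invgK (tree_lengthV lT) in E3.
have E4 := overlapE lT g (g * y); rewrite mulKg in E4.
tree_lia l.
Qed.

(** The length function with the base point moved to z. *)
Definition conj_length z x := l (z^-1 * x * z).

Lemma tree_length_conj z : tree_length (conj_length z).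
Proof.
have cM g h : z^-1 * g * z * (z^-1 * h * z) = z^-1 * (g * h) * z.
  by rewrite -!mulgA mulVKg.
have cV g : (z^-1 * g * z)^-1 = z^-1 * g^-1 * z by rewrite !invgM invgK mulgA.
split.
- by rewrite /conj_length mulg1 mulVg (tree_length1 lT).
- by move=> g; rewrite /conj_length -cV (tree_lengthV lT).
- by move=> g h; rewrite /conj_length -cM (tree_lengthM lT).
move=> g h k; rewrite /overlap /conj_length -!cM -!cV.
exact: (overlap_ultra lT).
Qed.

Lemma loxodromic_conj z t : ~~ loxodromic l t -> ~~ loxodromic (conj_length z) t.
Proof.
move=> tl; apply/negP => tz; 
pose N := (l t + 2 * l z).+1.
have := length_loxX_ge (tree_length_conj z) N tz; rewrite /conj_length.
have := length_ellX lT N tl.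
have := tree_lengthM lT (z^-1 * t ^+ N) z; have := tree_lengthM lT z^-1 (t ^+ N).
by rewrite (tree_lengthV lT) /N; tree_lia l.
Qed.

(** Two elliptic elements whose product is elliptic have a common fixed point:
    that of s0 nearest to the base point is fixed by each s which moves the
    base point no further than s0. *)
Lemma elliptic_common_fixpoint s0 s z m :
  ~~ loxodromic l s0 -> ~~ loxodromic l s -> ~~ loxodromic l (s * s0) ->
  l s0 = (2 * m)%N -> l z = m -> l (z^-1 * s0) = m -> l s <= 2 * m ->
  l (z^-1 * s * z) = 0.
Proof.
move=> e0 e1 e2 ls0 lz lzs0 le_s.
have fold t : ~~ loxodromic l t -> l t <= ov t^-1 t.
  rewrite /loxodromic -leqNgt => te; have := overlapE lT t^-1 t.
  by rewrite invgK (tree_lengthV lT); tree_lia l.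
have F0 := fold _ e0; have F1 := fold _ e1.
have lV t : l t^-1 = l t by rewrite (tree_lengthV lT).
(* If the segments to s and s0 parted before both midpoints, the fixed points
   of s and s0 would be disjoint and s * s0 loxodromic. *)
have S : l s <= ov s s0.
  rewrite leqNgt; apply/negP => lt.
  have F2 := fold _ e2; rewrite invgM in F2.
  have E1 := overlapE lT s (s * s0); rewrite mulKg in E1.
  have E2 := overlapE lT s0^-1 (s0^-1 * s^-1); rewrite mulKg in E2.
  have E3 := overlapE lT s^-1 s0; rewrite invgK in E3.
  have lss : l (s0^-1 * s^-1) = l (s * s0) by rewrite -invgM lV.
  have U1 := overlap_ultra lT s s0 s^-1.
  have U2 := overlap_ultra lT s s0 s0^-1.
  have U3 := overlap_ultra3 lT (g := s) (k := s * s0) (k' := s0^-1 * s^-1)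
    (h := s0^-1) (B := (ov s s0).+1).
  rewrite [ov (s * s0) _](overlapC lT) [ov _ s0^-1](overlapC lT) in U3.
  rewrite [ov s s^-1](overlapC lT) in U1.
  rewrite !lV in E1 E2 E3.
  have {}U3 : (ov s s0).+1 <= ov s s0^-1 by apply: U3; tree_lia l.
  tree_lia l.
(* z is the midpoint of the segment from 1 to s0, which s0 fixes. *)
have Z0 := overlapE lT z s0.
have Z1 := overlap_ultra lT z s0^-1 s0; rewrite [ov s0 _](overlapC lT) in Z1.
have Z2 : l (z^-1 * s0^-1 * z) = 0.
  have A1 := overlapE lT s0 z.
  have A2 := overlapE lT s0^-1 (s0^-1 * z); rewrite mulKg lV in A2.
  have A3 := overlapE lT z (s0^-1 * z); rewrite mulgA in A3.
  have A4 := overlap_ultra lT z (s0^-1 * z) s0^-1.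
  rewrite [ov s0 z](overlapC lT) in A1.
  tree_lia l.
(* From here on distances are measured from z. If s moved z, it would move it
   towards the base point; as s * s0 is elliptic, s0 would then fix a part of
   the segment from z to the base point, although it fixes only its end z. *)
have Tz := tree_length_conj z; set k := conj_length z in Tz.
apply/eqP; rewrite -leqn0 leqNgt; apply/negP => e_gt0.
have Ks0 : k s0 = 0 := etrans (esym (tree_lengthV Tz s0)) Z2.
have Kfold t : ~~ loxodromic l t -> k t <= overlap k t^-1 t.
  move=> /(loxodromic_conj z); rewrite /loxodromic -leqNgt -/k => te.
  by have := overlapE Tz t^-1 t; rewrite invgK (tree_lengthV Tz) -/k; tree_lia k.
have K1 := Kfold _ e1; have K2 := Kfold _ e2; rewrite invgM in K2.
have KE1 := overlapE Tz s (s * s0); rewrite mulKg -/k in KE1.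
have KM := length_triangleV Tz s (s * s0); rewrite mulKg -/k in KM.
have KM' := tree_lengthM Tz s s0; rewrite -/k in KM'.
have KU1 := overlap_ultra Tz (s0^-1 * s^-1) s (s * s0).
rewrite -/k [overlap k (s * s0) s](overlapC Tz) -/k in KU1.
have KU2 := overlap_ultra Tz (s0^-1 * s^-1) s^-1 s.
rewrite -/k [overlap k s s^-1](overlapC Tz) -/k in KU2.
(* In the new coordinates the old base point is the orbit point of z^-1. *)
pose q := z^-1.
have kq : k q = m by rewrite /k /conj_length /q -mulgA mulVg mulg1 lV.
have kqs : k (q^-1 * s^-1) <= m.
  rewrite /k /conj_length /q invgK mulKg.
  have A1 := overlapE lT s z; have A2 := overlap_ultra lT s z s0.
  rewrite [ov s0 z](overlapC lT) in A2; tree_lia l.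
have KE2 := overlapE Tz q s^-1; rewrite -/k (tree_lengthV Tz) -/k in KE2.
have KE3 := overlap_mull Tz q s^-1 s0^-1; rewrite -/k (tree_lengthV Tz) -/k in KE3.
have KU3 := overlap_ultra3 Tz (g := q) (k := s^-1) (k' := s0^-1 * s^-1)
  (h := s0^-1 * q) (B := 1).
rewrite -/k [overlap k s^-1 _](overlapC Tz) [overlap k _ (s0^-1 * q)](overlapC Tz) -/k in KU3.
have KE4 := overlapE Tz q (s0^-1 * q); rewrite -/k in KE4.
have kqq : k (q^-1 * (s0^-1 * q)) = (2 * m)%N.
  rewrite /k /conj_length /q invgK.
  by rewrite mulKg -mulgA mulVg mulg1 lV.
have KM2 := tree_lengthM Tz s0^-1 q; rewrite -/k (tree_lengthV Tz) -/k in KM2.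
have ks : 0 < k s by [].
have {}KU3 : 1 <= overlap k q (s0^-1 * q) by apply: KU3; tree_lia k.
tree_lia k.
Qed.

End FixedPoints.

Section Transfer.
Variables (G : groupType) (l1 l2 : G -> nat).
Hypotheses (T1 : tree_length l1) (T2 : tree_length l2).
Hypothesis T12 : tree_length (fun g => l1 g + l2 g).

(** In the tree of the combined lengths the rays agree on longer and longer
    segments; as these contain arbitrarily many edges of the second kind, the
    rays share an end in the second tree too. *)
Lemma same_end_transfer (x y t u : G) :
  loxodromic l1 t -> loxodromic l2 t -> loxodromic l1 u -> loxodromic l2 u ->
  same_end l1 (ray x t) (ray y u) -> same_end l2 (ray x t) (ray y u).
Proof.
move=> t1 t2 u1 u2 cv.
have q1 := quasi_ray_ray T1 x t1; have q2 := quasi_ray_ray T2 x t2.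
apply: (quasi_ray_unbounded T2 q2 (quasi_ray_ray T2 y u2)) => K.
have [[C1 A1] B1] := q1; have [[C2 A2] B2] := q2.
set a := ray x t in A1 A2 B1 B2 cv *; set b := ray y u in cv *.
have [n Hn] := B2 (K + C1 + C2); have {}Hn := Hn n (leqnn _).
have [n1 N1] := B1 (l1 (a n)); have [n2 N2] := B2 (l2 (a n)).
have [n3 N3] := cv (2 * (l1 (a n) + l2 (a n)))%N.
pose N := n1 + n2 + n3.
have {}N1 := N1 N ltac:(rewrite /N; lia); have {}N2 := N2 N ltac:(rewrite /N; lia).
have {}N3 := N3 N N ltac:(rewrite /N; lia) ltac:(rewrite /N; lia).
have := A1 n N; have := A2 n N => A2' A1'.
exists n, N.
have ovE g h : overlap (fun g => l1 g + l2 g) g h = overlap l1 g h + overlap l2 g h.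
  have := overlapE T1 g h; have := overlapE T2 g h; have := overlapE T12 g h => /=.
  lia.
have := overlap_ultra T12 (a n) (b N) (a N); rewrite !ovE.
have := overlap_le T1 (a n) (b N); lia.
Qed.

End Transfer.

(** * Cosets of subgroups of infinite index *)

Section Neumann.
Variables (G : groupType) (K : G -> Prop).
Hypotheses (K1 : K 1) (KM : forall x y, K x -> K y -> K (x * y))
  (KV : forall x, K x -> K x^-1).
Variables (I : eqType) (E : I -> G -> Prop).
Hypotheses (EM : forall i x y, E i x -> E i y -> E i (x * y))
  (EV : forall i x, E i x -> E i x^-1).

Definition infinite_index i := forall xs : seq G, {in xs, forall x, K x} ->
  exists2 y, K y & {in xs, forall x, ~ E i (x^-1 * y)}.

(** B.H. Neumann's lemma: a group is not a finite union of cosets of subgroups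
    of infinite index. A coset z * E i that is missed by the listed cosets of
    E i would be covered by cosets of the remaining subgroups, and translating
    it over the listed ones would eliminate E i from the covering. *)
Lemma avoid_cosets (s : seq I) : {in s, forall i, infinite_index i} ->
  forall xs : seq G, {in xs, forall x, K x} ->
  exists2 y, K y & {in s, forall i, {in xs, forall x, ~ E i (x^-1 * y)}}.
Proof.
elim: s => [|i s IH] inf xs Kxs; first by exists 1.
have [z Kz zE] := inf i (mem_head _ _) xs Kxs.
have infs : {in s, forall j, infinite_index j}.
  by move=> j js; apply: inf; rewrite inE js orbT.
pose xs' := xs ++ [seq x0 * z^-1 * x | x0 <- xs, x <- xs].
have Kxs' : {in xs', forall x, K x}.
  move=> x; rewrite mem_cat => /orP[/Kxs//|/allpairsP[[a b] /= [aX bX ->]]].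
  by apply: KM (Kxs _ bX); apply: KM (KV Kz); apply: Kxs.
have [y Ky yE] := IH infs xs' Kxs'.
case: (pselect (exists2 x0, x0 \in xs & E i (x0^-1 * y))) => [[x0 x0X Ey]|nE].
  exists (z * x0^-1 * y); first by apply: KM Ky; apply: KM Kz (KV (Kxs _ x0X)).
  move=> j; rewrite inE => /predU1P[->|js] x xX Ej.
    apply: (zE x xX); have := EM Ej (EV Ey).
    by rewrite invgM invgK -!mulgA mulVKg mulVg mulg1.
  apply: (yE j js (x0 * z^-1 * x)).
    by rewrite mem_cat; apply/orP; right; apply/allpairsP; exists (x0, x).
  by rewrite !invgM invgK; move: Ej; rewrite !mulgA.
exists y => // j; rewrite inE => /predU1P[->|js] x xX Ej.
  by apply: nE; exists x.
by apply: (yE j js x) => //; rewrite mem_cat xX.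
Qed.

Lemma distinct_cosets (s : seq I) : {in s, forall i, infinite_index i} ->
  forall n, exists f : nat -> G, (forall k, K (f k)) /\
    {in s, forall i, forall j k, j < k -> k < n -> ~ E i ((f j)^-1 * f k)}.
Proof.
move=> inf; elim=> [|n [f [Kf Hf]]]; first by exists (fun=> 1); split.
have [|y Ky Hy] := avoid_cosets inf (xs := [seq f k | k <- iota 0 n]).
  by move=> x /mapP[k _ ->].
exists (fun k => if k < n then f k else y); split=> [k|i si j k jk].
  by case: ifP.
rewrite ltnS leq_eqVlt => /predU1P[kn|kn]; last by rewrite kn (ltn_trans jk kn); apply: Hf.
rewrite kn ltnn -kn jk; apply: Hy => //; apply/mapP; exists j => //.
by rewrite mem_iota add0n -kn.
Qed.

End Neumann.

(** * Words up to commutation *)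

Section Traces.
Variables (V : choiceType) (e : rel V).
Hypotheses (e_sym : symmetric e) (e_irr : irreflexive e).
Local Notation letter := (V * bool)%type.
Implicit Types (a b c : letter) (u v w p q : seq letter) (x y : V).

Definition inv_letter a : letter := (a.1, ~~ a.2).

Lemma inv_letterK : involutive inv_letter.
Proof. by case=> x b; rewrite /inv_letter /= negbK. Qed.

Definition proj x y w := [seq a <- w | (a.1 == x) || (a.1 == y)].

(** Equality up to exchanging adjacent letters over adjacent vertices: two words
    are related in this way if and only if they have the same projections to
    all pairs of non-adjacent vertices. As an equality of projections it is
    cancellative and compatible with concatenation for free. *)
Definition teq u w := forall x y, ~~ e x y -> proj x y u = proj x y w.

Lemma teq_refl u : teq u u. Proof. by []. Qed.

Lemma teq_sym u w : teq u w -> teq w u.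
Proof. by move=> uw x y xy; rewrite uw. Qed.

Lemma teq_trans v u w : teq u v -> teq v w -> teq u w.
Proof. by move=> uv vw x y xy; rewrite uv ?vw. Qed.

Lemma teq_cat u u' w w' : teq u u' -> teq w w' -> teq (u ++ w) (u' ++ w').
Proof. by move=> uu ww x y xy; rewrite /proj !filter_cat -!/(proj _ _ _) uu ?ww. Qed.

Lemma teq_cons a u w : teq u w -> teq (a :: u) (a :: w).
Proof. by move=> uw; apply: (@teq_cat [:: a] [:: a]). Qed.

Lemma teq_cons_inj a u w : teq (a :: u) (a :: w) -> teq u w.
Proof. by move=> H x y /H /=; case: ifP => // _ []. Qed.

Lemma teq_cat_inj p u w : teq (p ++ u) (p ++ w) -> teq u w.
Proof. by elim: p => //= a p IH /teq_cons_inj. Qed.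

Lemma teq_swap a b u : e a.1 b.1 -> teq (a :: b :: u) (b :: a :: u).
Proof.
move=> ab x y xy; rewrite /proj /=; case: ifP => ha; case: ifP => hb //.
by case/orP: ha => /eqP ea; case/orP: hb => /eqP eb;
  move: ab xy; rewrite ea eb ?e_irr // => ab; rewrite ?ab // e_sym ab.
Qed.

(** The letter a can be moved to the front of w. *)
Fixpoint starts a w := if w is b :: w' then
  (b == a) || (e a.1 b.1 && starts a w') else false.

Fixpoint drop_first a w := if w is b :: w' then
  if b == a then w' else b :: drop_first a w' else [::].

Lemma starts_teq a w : starts a w -> teq w (a :: drop_first a w).
Proof.
elim: w => //= b w IH; case: eqP => [-> _|_ /= /andP[ab /IH wa]] //.
apply: teq_trans (teq_cons b wa) _; apply: teq_swap; by rewrite e_sym.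
Qed.

Lemma starts_proj a w :
  (forall y, ~~ e a.1 y -> ohead (proj a.1 y w) = Some a) -> starts a w.
Proof.
elim: w => [|b w IH] H; first by have := H a.1; rewrite e_irr => /(_ isT).
rewrite /=; case: eqP => //= ba.
have ab : e a.1 b.1.
  apply: contraT => /H; rewrite /proj /= eqxx orbT /= => -[] /esym.
  by move/esym/ba.
rewrite ab /=; apply: IH => y ay; rewrite -(H y ay) /proj /=.
case: eqP ab => [->|_]; first by rewrite e_irr.
by case: eqP => [->|]; rewrite ?(negPf ay).
Qed.

Lemma teq_starts a u w : teq (a :: u) w -> starts a w.
Proof.
by move=> H; apply: starts_proj => y ay; rewrite -(H _ _ ay) /proj /= eqxx.
Qed.

Lemma starts_congr a u w : teq u w -> starts a u = starts a w.
Proof.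
move=> uw; apply/idP/idP => /starts_teq H.
  exact: teq_starts (teq_trans (teq_sym H) uw).
exact: teq_starts (teq_trans (teq_sym H) (teq_sym uw)).
Qed.

Lemma teq_drop_first a u w : teq (a :: u) w -> teq u (drop_first a w).
Proof.
move=> H; have aw := teq_starts H; apply: (@teq_cons_inj a).
exact: teq_trans H (starts_teq aw).
Qed.

Lemma drop_first_congr a u w :
  starts a u -> teq u w -> teq (drop_first a u) (drop_first a w).
Proof. by move=> au uw; apply: teq_drop_first; apply: teq_trans uw; apply/teq_sym/starts_teq. Qed.

Lemma size_drop_first a w : starts a w -> size w = (size (drop_first a w)).+1.
Proof. by elim: w => //= b w IH; case: eqP => //= _ /andP[_ /IH ->]. Qed.

Lemma teq_perm u w : teq u w -> perm_eq u w.
Proof.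
elim: u w => [|a u IH] w H.
  case: w H => // b w /(_ b.1 b.1); rewrite /proj /= e_irr eqxx /=.
  by move/(_ isT).
have aw := teq_starts H; have /IH uw := teq_drop_first H.
have : perm_eq (a :: drop_first a w) w.
  elim: w aw {H uw} => //= b w IHw; case: eqP => [-> //|_ /= /andP[_ /IHw]].
  rewrite -(perm_cons b) => /(perm_trans _); apply.
  by apply/permP => P /=; lia.
by apply: perm_trans; rewrite perm_cons.
Qed.

Lemma teq_count P u w : teq u w -> count P u = count P w.
Proof. by move/teq_perm/permP. Qed.

Lemma teq_size u w : teq u w -> size u = size w.
Proof. by move/teq_perm/perm_size. Qed.

Lemma starts_cat a u w : starts a (u ++ w) =
  starts a u || (all (fun b => e a.1 b.1) u && starts a w).
Proof. by elim: u => //= b u ->; case: eqP => //= _; case: (e _ _). Qed.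

Lemma drop_first_cat a u w : starts a w -> all (fun b => e a.1 b.1) u ->
  drop_first a (u ++ w) = u ++ drop_first a w.
Proof.
by move=> aw; elim: u => //= b u IH /andP[ab /IH ->]; case: eqP ab => // ->; rewrite e_irr.
Qed.

Lemma starts_mem a w : starts a w -> a \in w.
Proof.
by elim: w => //= b w IH; rewrite inE eq_sym; case: eqP => //= _ /andP[_ /IH].
Qed.

(** No two letters cancel, even after exchanges. *)
Fixpoint reduced w := if w is a :: w' then
  ~~ starts (inv_letter a) w' && reduced w' else true.

Lemma reduced_of_drop a w : starts a w -> reduced (drop_first a w) ->
  ~~ starts (inv_letter a) (drop_first a w) -> reduced w.
Proof.
elim: w => //= b w IH; case: eqP => [-> _ -> ->//|ba /= /andP[ab aw]].
move=> /andP[nb rw]; rewrite negb_or => /andP[_].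
rewrite /= ab /= => na; rewrite (IH aw rw na) andbT.
rewrite (starts_congr _ (starts_teq aw)) /= negb_or; apply/andP; split.
  by apply: contraL ab => /eqP ->; rewrite e_irr.
by rewrite negb_and nb orbT.
Qed.

Lemma reduced_congr u w : teq u w -> reduced u -> reduced w.
Proof.
elim: u w => [|a u IH] w H /=.
  by move/teq_size: H => /esym/size0nil ->.
move=> /andP[au ru]; have H' := teq_drop_first H.
apply: (@reduced_of_drop a); [exact: teq_starts H|exact: IH H' ru|].
by rewrite -(starts_congr _ H').
Qed.

Lemma reduced_catr u w : reduced (u ++ w) -> reduced w.
Proof. by elim: u => //= a u IH /andP[_ /IH]. Qed.

Lemma reduced_catl u w : reduced (u ++ w) -> reduced u.
Proof.
elim: u => //= a u IH /andP[]; rewrite starts_cat negb_or => /andP[-> _] /IH.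
by [].
Qed.

(** Left multiplication by a letter, on reduced words. As it respects the
    defining relations (actK, act_comm), reduced words of equal elements are
    equal up to exchanges. *)
Definition act a w := if starts (inv_letter a) w
  then drop_first (inv_letter a) w else a :: w.

Definition nf w := foldr act [::] w.

Lemma reduced_drop a w : starts a w -> reduced w -> reduced (drop_first a w).
Proof. by move=> /starts_teq H /(reduced_congr H) /= /andP[]. Qed.

Lemma reduced_act a w : reduced w -> reduced (act a w).
Proof.
move=> rw; rewrite /act; case: ifP => [s|/negbT s]; first exact: reduced_drop.
by rewrite /= s.
Qed.

Lemma reduced_nf w : reduced (nf w).
Proof. by elim: w => //= a w; apply: reduced_act. Qed.

Lemma nf_id w : reduced w -> nf w = w.
Proof. by elim: w => //= a w IH /andP[/negPf na /IH ->]; rewrite /act na. Qed.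

Lemma act_congr a u w : teq u w -> teq (act a u) (act a w).
Proof.
move=> uw; rewrite /act -(starts_congr _ uw); case: ifP => s.
  exact: drop_first_congr.
exact: teq_cons.
Qed.

Lemma actK a w : reduced w -> teq (act a (act (inv_letter a) w)) w.
Proof.
move=> rw; rewrite {2}/act inv_letterK; case: ifP => [s|/negbT ns].
  have := starts_teq s; move/reduced_congr/(_ rw) => /= /andP[na _].
  by rewrite /act (negPf na); apply/teq_sym/starts_teq.
by rewrite /act /= eqxx.
Qed.

Lemma act_comm a b w : e a.1 b.1 -> teq (act a (act b w)) (act b (act a w)).
Proof.
move=> ab; have ba : e b.1 a.1 by rewrite e_sym.
have nab c d : e c.1 d.1 -> (c == d) = false.
  by move=> cd; apply: contraTF cd => /eqP ->; rewrite e_irr.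
have nabI c d : e c.1 d.1 -> (c == inv_letter d) = false by move=> cd; exact: nab.
have key c d : e c.1 d.1 -> starts (inv_letter c) w ->
    starts (inv_letter c) (act d w).
  move=> cd sc; have dc : e d.1 c.1 by rewrite e_sym.
  rewrite {1}/act; case: ifP => sd; last by rewrite /= cd sc orbT.
  have := starts_teq sd; move/(starts_congr (inv_letter c)).
  by rewrite sc /= nabI //= cd.
have nkey c d : e c.1 d.1 -> starts (inv_letter c) w = false ->
    starts (inv_letter c) (act d w) = false.
  move=> cd sc; have dc : e d.1 c.1 by rewrite e_sym.
  rewrite {1}/act; case: ifP => sd; last by rewrite /= cd sc nabI.
  have := starts_teq sd; move/(starts_congr (inv_letter c)).
  by rewrite sc /= nabI //= cd.
case sa: (starts (inv_letter a) w); case sb: (starts (inv_letter b) w).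
- rewrite /act sb sa; have := key _ _ ab sa; have := key _ _ ba sb.
  rewrite /act sb sa => sb' sa'; rewrite sb' sa'.
  apply: teq_drop_first; apply: (@teq_cons_inj (inv_letter a)).
  apply: teq_trans (teq_swap _ _) _ => //.
  apply: teq_trans (teq_cons _ (teq_sym (starts_teq sa'))) _.
  apply: teq_trans (teq_sym (starts_teq sb)) _; exact: starts_teq.
- have sa' := key _ _ ab sa; have sb' := nkey _ _ ba sb.
  rewrite {1}/act sa' {2}/act sb' /act sb sa /=.
  by rewrite nabI.
- have sa' := nkey _ _ ab sa; have sb' := key _ _ ba sb.
  rewrite {1}/act sa' {2}/act sb' /act sb sa /=.
  by rewrite nabI.
have sa' := nkey _ _ ab sa; have sb' := nkey _ _ ba sb.
rewrite {1}/act sa' {2}/act sb' /act sb sa /=.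
exact: teq_swap.
Qed.

Lemma count_drop_first P a w : count P (drop_first a w) <= count P w.
Proof. by elim: w => //= b w IH; case: ifP => _ /=; lia. Qed.

Lemma count_nf P w : count P (nf w) <= count P w.
Proof.
elim: w => //= a w IH; rewrite /act; case: ifP => _ /=; last by lia.
by have := count_drop_first P (inv_letter a) (nf w); lia.
Qed.

Lemma inv_word_cons a w : inv_word (a :: w) = inv_word w ++ [:: inv_letter a].
Proof. by rewrite /inv_word /= rev_cons -cats1. Qed.

(** A cancellation in u ++ w pairs a letter that can be moved to the end of u
    with one that can be moved to the front of w. *)
Lemma reduced_cat u w : reduced u -> reduced w ->
  (forall a, starts a (inv_word u) -> ~~ starts a w) -> reduced (u ++ w).
Proof.
elim: u => //= a u IH /andP[na ru] rw nc; rewrite IH //; last first.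
  by move=> c cu; apply: nc; rewrite inv_word_cons starts_cat cu.
rewrite andbT starts_cat negb_or na /=; apply/negP => /andP[au aw].
suff /nc/negP : starts (inv_letter a) (inv_word (a :: u)) by [].
rewrite inv_word_cons starts_cat /= eqxx andbT; apply/orP; right.
by rewrite all_rev all_map; apply: sub_all au.
Qed.

Lemma reduced_inv w : reduced w -> reduced (inv_word w).
Proof.
elim: w => //= a w IH /andP[na rw]; rewrite inv_word_cons reduced_cat ?IH //.
move=> c; rewrite inv_wordK /= andbF orbF => cw; apply: contra na => /eqP ->.
by [].
Qed.

Lemma common_prefix u w : exists p u' w',
  [/\ teq u (p ++ u'), teq w (p ++ w') & forall a, starts a u' -> ~~ starts a w'].
Proof.
have [n] := ubnP (size u); elim: n u w => // n IH u w le_n.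
case: (boolP (has (fun a => starts a w) [seq a <- u | starts a u])); last first.
  move=> /hasPn H; exists [::], u, w; split=> // a au; apply: H.
  by rewrite mem_filter au starts_mem.
move=> /hasP[a]; rewrite mem_filter => /andP[au _] aw.
have su := size_drop_first au.
have [|p [u' [w' [eu ew nc]]]] := IH (drop_first a u) (drop_first a w); first by lia.
exists (a :: p), u', w'; split=> //=.
  exact: teq_trans (starts_teq au) (teq_cons _ eu).
exact: teq_trans (starts_teq aw) (teq_cons _ ew).
Qed.

(** Levi's lemma: if p and q have no common first letter, exchanges leading from
    p ++ p' to q ++ q' move every letter of q past every letter of p. *)
Lemma levi_commute p p' q q' : teq (p ++ p') (q ++ q') ->
  (forall a, starts a p -> ~~ starts a q) ->
  {in p & q, forall a b, e a.1 b.1}.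
Proof.
elim: p p' q' => [|a p IH] p' q' H nc c d; first by rewrite in_nil.
have := teq_starts H; rewrite starts_cat (negPf (nc _ _)) /= ?eqxx //.
move=> /andP[aq aq'].
have H' := teq_drop_first H; rewrite drop_first_cat // in H'.
rewrite inE => /predU1P[-> dq|cp dq]; first exact: (allP aq).
apply: (IH _ _ H') cp dq => b bp; apply/negP => bq.
suff : ~~ starts b q by rewrite bq.
by apply: nc; rewrite /= bp andbT e_sym (allP aq) ?starts_mem // orbT.
Qed.

End Traces.

(** * Letter counts in a right-angled Artin group *)

Section RaagLength.
Variable Gamma : sgraph.
Let G : groupType := raag Gamma.
Local Notation adj := (@adj Gamma).
Local Notation letter := (Gamma * bool)%type.
Local Notation teq := (teq adj).
Local Notation nf := (nf adj).
Local Notation reduced := (reduced adj).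
Local Notation starts := (starts adj).
Let e_sym : symmetric adj := @adj_sym Gamma.
Let e_irr : irreflexive adj := @adj_irr Gamma.
Implicit Types (g h z : G) (u w p q : seq letter) (a b : letter) (v : Gamma).
Implicit Types P : pred Gamma.

Definition cls w : G := pres_class (@raag_rels Gamma) w.

Lemma cls_cat u w : cls (u ++ w) = cls u * cls w.
Proof. by rewrite /cls -pres_class_mul. Qed.

Lemma cls_nil : cls [::] = 1. Proof. by []. Qed.

Lemma cls_cons a w : cls (a :: w) = cls [:: a] * cls w.
Proof. by rewrite -cls_cat. Qed.

Lemma cls_inv w : cls (inv_word w) = (cls w)^-1.
Proof. by rewrite /cls -pres_class_inv. Qed.

Lemma cls_letterV a : cls [:: inv_letter a] = (cls [:: a])^-1.
Proof. by rewrite -cls_inv. Qed.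

Lemma cls_adj a b : adj a.1 b.1 -> commute (cls [:: a]) (cls [:: b]).
Proof.
case: a b => [x i] [y j] /= xy.
have E : commute (cls [:: (x, false)]) (cls [:: (y, false)]).
  apply/commgP/eqP.
  have -> : [~ cls [:: (x, false)], cls [:: (y, false)]] = cls (comm_word x y).
    have -> : cls (comm_word x y) = cls [:: (x, true)] * (cls [:: (y, true)] *
        (cls [:: (x, false)] * cls [:: (y, false)])) by rewrite -!cls_cat.
    by rewrite (cls_letterV (x, false)) (cls_letterV (y, false)).
  apply/pres_classP; have := @pres_relator _ (@raag_rels Gamma) [::] [::] (comm_word x y).
  by rewrite cats0 /= => H; apply: rst_step; apply: H; exists x, y.
have E2 k : commute (cls [:: (x, false)]) (cls [:: (y, k)]).
  by case: k => //; have := cls_letterV (y, false) => ->; apply: commuteV.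
case: i => //; have := cls_letterV (x, false) => ->.
exact/commute_sym/commuteV/commute_sym.
Qed.

Lemma cls_starts a w : starts a w -> cls w = cls (a :: drop_first a w).
Proof.
elim: w => //= b w IH; case: eqP => [-> //|_ /= /andP[ab aw]].
set r := drop_first a w in IH *.
rewrite (cls_cons b w) IH // (cls_cons a r) (cls_cons a (b :: r)) (cls_cons b r).
by rewrite !mulgA; congr (_ * _); apply/commute_sym/cls_adj.
Qed.

Lemma cls_teq u w : teq u w -> cls u = cls w.
Proof.
elim: u w => [|a u IH] w H; first by have := teq_size e_sym e_irr H => /esym/size0nil ->.
rewrite (cls_starts (teq_starts e_irr H)) cls_cons [RHS]cls_cons.
by rewrite (IH _ (teq_drop_first e_sym e_irr H)).
Qed.

Lemma cls_nf w : cls (nf w) = cls w.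
Proof.
elim: w => //= a w IH; rewrite cls_cons -IH /act; case: ifP => s; last by rewrite -cls_cons.
by rewrite (cls_starts s) (cls_cons (inv_letter a)) cls_letterV mulVKg.
Qed.

Lemma nf_cat_congr p u w : teq (nf u) (nf w) -> teq (nf (p ++ u)) (nf (p ++ w)).
Proof. by move=> uw; elim: p => //= a p IH; apply: act_congr. Qed.

Lemma nf_pres u w : cls u = cls w -> teq (nf u) (nf w).
Proof.
move/pres_classP; elim=> {u w} [u w [p q x b|p q r [x [y [xy ->]]]]|u|u w _|u v w _ ? _].
- apply: nf_cat_congr; exact: (@actK _ _ e_sym e_irr (x, b) _ (reduced_nf e_sym e_irr q)).
- apply: nf_cat_congr => /=; set z := nf q.
  have rz : reduced z by apply: reduced_nf.
  have yx : adj (y, true).1 (x, false).1 by rewrite e_sym.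
  apply: (@teq_trans _ _ (act adj (x, true) (act adj (x, false) z))); last first.
    exact: (@actK _ _ e_sym e_irr (x, true)).
  apply: act_congr => //; apply: teq_trans (act_comm e_sym e_irr _ yx) _.
  apply: act_congr => //; exact: (@actK _ _ e_sym e_irr (y, true)).
- exact: teq_refl.
- exact: teq_sym.
- exact: teq_trans.
Qed.

Definition reduced_word g : seq letter := nf (repr g).

Lemma reduced_reduced_word g : reduced (reduced_word g).
Proof. exact: reduced_nf. Qed.

Lemma cls_reduced_word g : cls (reduced_word g) = g.
Proof. by rewrite cls_nf; apply: pres_class_repr. Qed.

Lemma reduced_wordE w g : reduced w -> cls w = g -> teq (reduced_word g) w.
Proof.
move=> rw <-; rewrite -[X in teq _ X](nf_id rw).
by apply: nf_pres; apply: pres_class_repr.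
Qed.

(** The number of letters of a reduced word of g over the vertices in P. When P
    is independent this is the distance between the base point and its image
    by g in a tree: the one dual to the hyperplanes with labels in P of the
    cube complex on which the group acts. *)
Definition len P g : nat := count (fun a => P a.1) (reduced_word g).

Lemma len_cls P w : len P (cls w) <= count (fun a => P a.1) w.
Proof.
apply: leq_trans (count_nf adj _ w); rewrite /len leq_eqVlt.
have E := reduced_wordE (reduced_nf e_sym e_irr w) (cls_nf w).
rewrite (teq_count e_sym e_irr (fun a => P a.1) E).
by rewrite eqxx.
Qed.

Lemma len_reduced P w : reduced w -> len P (cls w) = count (fun a => P a.1) w.
Proof. by move=> rw; rewrite /len (teq_count e_sym e_irr _ (reduced_wordE rw erefl)). Qed.

Lemma len1 P : len P 1 = 0.
Proof. by apply/eqP; rewrite -leqn0 -cls_nil; apply: len_cls. Qed.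

Lemma count_inv P w : count (fun a => P a.1) (inv_word w) = count (fun a => P a.1) w.
Proof. by rewrite /inv_word count_rev count_map. Qed.

Lemma lenV P g : len P g^-1 = len P g.
Proof.
have le x : len P x^-1 <= len P x.
  by rewrite -{1}(cls_reduced_word x) -cls_inv (leq_trans (len_cls _ _)) ?count_inv.
by apply/eqP; rewrite eqn_leq le -{1}[g]invgK le.
Qed.

Lemma lenM P g h : len P (g * h) <= len P g + len P h.
Proof.
rewrite -{1}(cls_reduced_word g) -{1}(cls_reduced_word h) -cls_cat.
by apply: leq_trans (len_cls _ _) _; rewrite count_cat.
Qed.

(** The greatest common prefix of reduced words of g and h spells the path on
    which the segments from 1 to g and to h agree, in every tree at once. *)
Lemma overlap_common_prefix g h : exists p u w,
  [/\ teq (reduced_word g) (p ++ u), teq (reduced_word h) (p ++ w) &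
  forall P, overlap (len P) g h = (2 * count (fun a => P a.1) p)%N].
Proof.
have [p [u [w [gp hp nc]]]] := common_prefix e_sym e_irr (reduced_word g) (reduced_word h).
exists p, u, w; split=> // P.
have ru : reduced u.
  exact: reduced_catr (reduced_congr e_sym e_irr gp (reduced_reduced_word g)).
have rw : reduced w.
  exact: reduced_catr (reduced_congr e_sym e_irr hp (reduced_reduced_word h)).
have red : reduced (inv_word u ++ w).
  by apply: reduced_cat => //; [exact: reduced_inv|move=> a; rewrite inv_wordK; exact: nc].
have E : g^-1 * h = cls (inv_word u ++ w).
  rewrite -{1}(cls_reduced_word g) -{1}(cls_reduced_word h).
  rewrite (cls_teq gp) (cls_teq hp) !cls_cat cls_inv invgM -mulgA mulKg //.
rewrite /overlap E len_reduced // /len (teq_count e_sym e_irr _ gp) (teq_count e_sym e_irr _ hp).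
rewrite !count_cat count_inv.
by move: (count _ p) (count _ u) (count _ w) => *; lia.
Qed.

Lemma overlap_prefix P g h p u w :
  teq (reduced_word g) (p ++ u) -> teq (reduced_word h) (p ++ w) ->
  2 * count (fun a => P a.1) p <= overlap (len P) g h.
Proof.
move=> gp hp.
have E : g^-1 * h = cls (inv_word u ++ w).
  rewrite -{1}(cls_reduced_word g) -{1}(cls_reduced_word h).
  rewrite (cls_teq gp) (cls_teq hp) !cls_cat cls_inv invgM -mulgA mulKg //.
have := len_cls P (inv_word u ++ w); rewrite -E.
rewrite /overlap [len P g]/len [len P h]/len.
rewrite (teq_count e_sym e_irr _ gp) (teq_count e_sym e_irr _ hp).
rewrite !count_cat count_inv.
by move: (count _ p) (count _ u) (count _ w) => *; lia.
Qed.

Definition independent P := forall x y, P x -> P y -> ~~ adj x y.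

(** Two prefixes p and q of a word of k, from which common letters have been
    removed, commute letter by letter (levi_commute); hence only one of them
    has letters in an independent set P, and the common prefix of p and q
    contains all P-letters of p or all P-letters of q. *)
Lemma tree_length_len P : independent P -> tree_length (len P).
Proof.
move=> iP; split; [exact: len1|exact: lenV|exact: lenM|] => g h k.
have [p [u [p' [gp kp ->]]]] := overlap_common_prefix g k.
have [q [q' [w [kq hq ->]]]] := overlap_common_prefix k h.
have [m [p1 [q1 [pm qm nc]]]] := common_prefix e_sym e_irr p q.
have gm : teq (reduced_word g) (m ++ (p1 ++ u)).
  by apply: teq_trans gp _; rewrite catA; apply: teq_cat.
have hm : teq (reduced_word h) (m ++ (q1 ++ w)).
  by apply: teq_trans hq _; rewrite catA; apply: teq_cat.
apply: leq_trans (overlap_prefix P gm hm).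
have LV : teq (p1 ++ p') (q1 ++ q').
  apply: (@teq_cat_inj _ _ m); rewrite !catA.
  apply: teq_trans (teq_cat (teq_sym pm) (teq_refl _)) _.
  apply: teq_trans (teq_sym kp) _; apply: teq_trans kq _.
  exact: teq_cat qm (teq_refl _).
have comm := levi_commute e_sym e_irr LV nc.
rewrite (teq_count e_sym e_irr _ pm) (teq_count e_sym e_irr _ qm) !count_cat.
case: (posnP (count (fun a => P a.1) p1)) => [->|].
  by rewrite addn0 geq_minl.
case: (posnP (count (fun a => P a.1) q1)) => [->|].
  by rewrite addn0 geq_minr.
rewrite -!has_count => /hasP[b bq Pb] /hasP[a ap Pa].
by have := iP _ _ Pa Pb; rewrite comm.
Qed.



Definition ell v g : nat := len (pred1 v) g.

Lemma tree_length_ell v : tree_length (ell v).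
Proof. by apply: tree_length_len => x y /eqP -> /eqP ->; rewrite e_irr. Qed.

Lemma len_pair (u v : Gamma) g : u != v -> len (pred2 u v) g = ell u g + ell v g.
Proof.
move=> uv; rewrite /ell /len; elim: (reduced_word g) => //= a w ->.
by case: eqP => [->|]; rewrite ?(negPf uv) //=; case: eqP => _ //=; lia.
Qed.

(** Two non-adjacent vertices have a common tree, of which the trees of u and v
    are collapses; this is what relates the ends of different trees. *)
Lemma tree_length_pair (u v : Gamma) : u != v -> ~~ adj u v ->
  tree_length (fun g => ell u g + ell v g).
Proof.
move=> uv nuv; have -> : (fun g => ell u g + ell v g) = len (pred2 u v).
  by apply/funext => g; rewrite len_pair.
apply: tree_length_len => x y /orP[] /eqP -> /orP[] /eqP ->; rewrite ?e_irr //.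
by rewrite e_sym.
Qed.

Lemma lenE P g : len P g = \sum_(v | P v) ell v g.
Proof.
rewrite /ell /len; elim: (reduced_word g) => [|a w /= ->]; first by rewrite /= big1.
rewrite big_split /=; congr (_ + _); case: (boolP (P a.1)) => Pa.
  rewrite (bigD1 a.1) //= eqxx big1 ?addn0 // => v /andP[_].
  by rewrite eq_sym => /negPf ->.
rewrite big1 // => v Pv; case: eqP => // av; by rewrite av Pv in Pa.
Qed.

Lemma ell_bounded_finite C : exists s : seq G,
  forall g, (forall v, ell v g <= C) -> g \in s.
Proof.
exists [seq cls (val t) | t : {bseq (#|Gamma| * C) of letter}] => g gC.
have sz : size (reduced_word g) <= #|Gamma| * C.
  have <- : len predT g = size (reduced_word g) by rewrite /len count_predT.
  rewrite lenE -sum_nat_const; apply: leq_sum => v _; exact: gC.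
apply/mapP; exists (Bseq sz); first by rewrite mem_enum.
by rewrite cls_reduced_word.
Qed.

Lemma ell_prefix v g m : m <= ell v g ->
  exists2 z, ell v z = m & ell v (z^-1 * g) = ell v g - m.
Proof.
have [k] : exists k, count (fun a => a.1 == v) (take k (reduced_word g)) =
    minn m (ell v g).
  rewrite /ell /len; elim: (reduced_word g) m => [|a w IH] m; first by exists 0.
  case: m => [|m]; first by exists 0; rewrite take0 min0n.
  case: (eqVneq a.1 v) => av.
    by have [k Hk] := IH m; exists k.+1; rewrite /= av eqxx Hk minnSS.
  by have [k Hk] := IH m.+1; exists k.+1; rewrite /= (negPf av) Hk.
set w := reduced_word g => Ek le_m; rewrite (minn_idPl le_m) in Ek.
have rw : reduced (take k w ++ drop k w) by rewrite cat_take_drop; apply: reduced_reduced_word.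
have wg : cls (take k w) * cls (drop k w) = g.
  by rewrite -cls_cat cat_take_drop cls_reduced_word.
exists (cls (take k w)); first by rewrite /ell len_reduced ?(reduced_catl rw).
rewrite -{1}wg mulKg /ell len_reduced ?(reduced_catr rw) // /len -/w.
by rewrite -{2}(cat_take_drop k w) count_cat Ek addKn.
Qed.

Lemma exponent_cls v u w : cls u = cls w ->
  count_mem (v, false) u + count_mem (v, true) w =
  count_mem (v, false) w + count_mem (v, true) u.
Proof.
move/pres_classP; elim=> {u w} [u w [p q x b|p q r [x [y [xy ->]]]]|u|u w _ ->|u t w _ H1 _ H2] //.
- rewrite !count_cat /= !xpair_eqE; case: (x == v); case: b => /=; lia.
- by rewrite !count_cat /= !xpair_eqE; case: (x == v); case: (y == v) => /=; lia.
- lia.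
Qed.

(** The exponent sum of v is a homomorphism bounded by the length, so it
    vanishes on an element whose powers stay bounded; and it has the parity of
    the length. In geometric terms, no edge of the tree is inverted. *)
Lemma odd_loxodromic v g : odd (ell v g) -> loxodromic (ell v) g.
Proof.
apply: contraLR => ng; have eX n := length_ellX (tree_length_ell v) n ng.
set w := reduced_word g.
pose np := count_mem (v, false) w; pose nn := count_mem (v, true) w.
have ellE h : ell v h =
    count_mem (v, false) (reduced_word h) + count_mem (v, true) (reduced_word h).
  rewrite /ell /len; elim: (reduced_word h) => //= -[x b] s ->.
  by rewrite !xpair_eqE /=; case: (x == v); case: b => /=; lia.
have expo n : count_mem (v, false) (reduced_word (g ^+ n)) + n * nn =
    count_mem (v, true) (reduced_word (g ^+ n)) + n * np.
  have E : cls (reduced_word (g ^+ n)) = cls (flatten (nseq n w)).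
    rewrite cls_reduced_word; elim: n => //= n IH.
    by rewrite cls_cat -IH cls_reduced_word expgS.
  have := exponent_cls v E.
  have cn (b : bool) : count_mem (v, b) (flatten (nseq n w)) = (n * count_mem (v, b) w)%N.
    by rewrite count_flatten map_nseq sumn_nseq mulnC.
  by rewrite !cn -/np -/nn; lia.
have En := expo (ell v g).+1; have Ln := eX (ell v g).+1.
rewrite ellE in Ln; have Eg := ellE g; rewrite -/w -/np -/nn in Eg.
have nE : np = nn.
  have [lt|lt|//] := ltngtP np nn; exfalso; nia.
by rewrite Eg nE addnn odd_double.
Qed.

(** Take a shortest representative z0 of the vertex z of the v-tree: a final
    letter of z0 cancelling against an element without v-letters could be
    removed from z0 without changing the vertex. *)
Lemma shortest_representative v z : exists z0, ell v (z^-1 * z0) = 0 /\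
  forall y, ell v y = 0 -> forall u : Gamma, ell u (z0 * y) = ell u z0 + ell u y.
Proof.
pose Q n := `[< exists2 z0, ell v (z^-1 * z0) = 0 & len predT z0 = n >].
have exQ : exists n, Q n.
  by exists (len predT z); apply/asboolP; exists z => //; rewrite mulVg /ell len1.
case: (ex_minnP exQ) => n /asboolP[z0 vz0 nz0] min.
exists z0; split=> // y vy u.
rewrite -{1}(cls_reduced_word z0) -{1}(cls_reduced_word y) -cls_cat /ell.
rewrite len_reduced ?count_cat //; apply: reduced_cat; do ?exact: reduced_reduced_word.
move=> a az; apply/negP => /starts_mem ay.
have av : a.1 != v.
  apply: contraTN ay => av; move/eqP: vy; rewrite /ell /len -leqn0 leqNgt -has_count.
  by move/hasPn => na; apply/negP => /na; rewrite /= av.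
have E := cls_starts az; rewrite cls_inv cls_reduced_word in E.
set r := drop_first _ _ in E.
have E2 : z0 * cls [:: a] = (cls r)^-1.
  by rewrite -[z0]invgK E cls_cons invgM -mulgA mulVg mulg1.
have := min (len predT (z0 * cls [:: a])).
have le_r : len predT (z0 * cls [:: a]) < n.
  rewrite E2 lenV (leq_ltn_trans (len_cls _ _)) // -nz0 -lenV /len.
  have rz : reduced (inv_word (reduced_word z0)).
    by apply: reduced_inv => //; apply: reduced_reduced_word.
  have := teq_count e_sym e_irr predT (reduced_wordE rz _).
  rewrite cls_inv cls_reduced_word => /(_ _ erefl) ->.
  rewrite !count_predT (size_drop_first az) //.
rewrite leqNgt le_r => H; suff : false by [].
apply: H; apply/asboolP; exists (z0 * cls [:: a]) => //.
apply/eqP; rewrite -leqn0 mulgA (leq_trans (lenM _ _ _)) // -/(ell _ _) vz0 add0n.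
by rewrite (leq_trans (len_cls _ _)) //= (negPf av).
Qed.

(** The case of interest: D is a connected component of the complement of the
    graph induced on L. An element supported in L is then the product of two
    commuting factors, with letters in D and outside D. *)
Section Component.
Variables (L D : pred Gamma).
Hypothesis LD : forall x y, L x -> ~~ D x -> D y -> adj x y.

Definition supported g := forall v, ~~ L v -> ell v g = 0.

Lemma supportedM g h : supported g -> supported h -> supported (g * h).
Proof.
by move=> sg sh v Lv; apply/eqP; rewrite -leqn0 (leq_trans (lenM _ _ _)) // -!/(ell _ _) sg ?sh.
Qed.

Lemma supportedV g : supported g -> supported g^-1.
Proof. by move=> sg v Lv; rewrite /ell lenV -/(ell _ _) sg. Qed.

Lemma supported_all g : supported g -> all (fun a => L a.1) (reduced_word g).
Proof.
move=> sg; apply/allP => a ag; apply: contraT => /sg/eqP.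
rewrite /ell /len -leqn0 leqNgt -has_count => /hasPn/(_ a ag).
by rewrite /= eqxx.
Qed.

Lemma cls_commute u w : {in u & w, forall a b, adj a.1 b.1} ->
  commute (cls u) (cls w).
Proof.
move=> uw; elim: u uw => [|a u IH] uw; first exact/commute_sym/commute1.
rewrite (cls_cons a); apply/commute_sym/commuteM.
  apply/commute_sym; elim: w uw {IH} => [|b w IHw] uw; first exact: commute1.
  rewrite (cls_cons b); apply: commuteM; last first.
    by apply: IHw => c d cu dw; apply: uw => //; rewrite inE dw orbT.
  by apply: cls_adj; apply: uw; rewrite mem_head.
by apply/commute_sym/IH => c d cu; apply: uw; rewrite inE cu orbT.
Qed.

Lemma cls_split w : all (fun a => L a.1) w ->
  cls w = cls [seq a <- w | D a.1] * cls [seq a <- w | ~~ D a.1].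
Proof.
elim: w => [|a w IH] /=; first by rewrite cls_nil mulg1.
move=> /andP[La Lw]; rewrite (cls_cons a w) IH //.
case: (boolP (D a.1)) => Da /=.
  by rewrite [in RHS]cls_cons mulgA.
rewrite [X in _ = _ * X]cls_cons !mulgA; congr (_ * _).
apply: cls_commute => b c; rewrite inE mem_filter => /eqP -> /andP[Dc _].
exact: LD.
Qed.

Definition inner g := cls [seq a <- reduced_word g | D a.1].
Definition outer g := cls [seq a <- reduced_word g | ~~ D a.1].

Lemma inner_outer g : supported g -> g = inner g * outer g.
Proof. by move=> /supported_all/cls_split <-; rewrite cls_reduced_word. Qed.

Lemma len_outer g : len D (outer g) = 0.
Proof.
apply/eqP; rewrite -leqn0 (leq_trans (len_cls _ _)) // count_filter leqn0 eqn0Ngt -has_count.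
by apply/hasPn => a _ /=; case: (D a.1).
Qed.

Lemma len0_conj g z : supported g -> supported z -> len D z = 0 ->
  len D (g^-1 * z * g) = 0.
Proof.
move=> sg sz z0; have zE : z = cls (reduced_word z) by rewrite cls_reduced_word.
have zD : ~~ has (fun a => D a.1) (reduced_word z).
  by rewrite has_count -/(len D z) z0.
have zc : commute z (inner g).
  rewrite zE; apply: cls_commute => a b az; rewrite mem_filter => /andP[Db _].
  apply: LD => //; first exact: (allP (supported_all sz)).
  exact: (hasPn zD).
rewrite {1 2}(inner_outer sg) invgM -!mulgA [z * _]mulgA zc -mulgA mulKg.
apply/eqP; rewrite -leqn0 mulgA.
rewrite (leq_trans (lenM _ _ _)) // (leq_trans (leq_add (lenM _ _ _) (leqnn _))) //.
by rewrite lenV len_outer z0.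
Qed.

(** Up to letters outside D there are only finitely many elements of bounded
    D-length. *)
Lemma len_pigeonhole B (f : nat -> G) : (forall n, supported (f n)) ->
  (forall n, len D (f n) <= B) -> exists n m, n < m /\ len D ((f n)^-1 * f m) = 0.
Proof.
move=> sf fB.
have sz n : size [seq a <- reduced_word (f n) | D a.1] <= B by rewrite size_filter fB.
pose c (i : 'I_(#|{bseq B of letter}|.+1)) : {bseq B of letter} := Bseq (sz i).
have : ~~ injectiveb c.
  by apply/negP => /injectiveP/leq_card; rewrite card_ord ltnn.
move=> /injectivePn[i [j ij cij]].
have {}cij : inner (f i) = inner (f j) by rewrite /inner; move/(congr1 val): cij => /= ->.
have E (k k' : nat) : inner (f k) = inner (f k') -> len D ((f k)^-1 * f k') = 0.
  move=> kk; rewrite {1}(inner_outer (sf k)) {1}(inner_outer (sf k')) kk.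
  rewrite invgM -mulgA mulKg; apply/eqP; rewrite -leqn0.
  by rewrite (leq_trans (lenM _ _ _)) // lenV !len_outer.
have [lt|lt|/val_inj eq] := ltngtP i j; last by rewrite eq eqxx in ij.
  by exists i, j; split=> //; apply: E.
by exists j, i; split=> //; apply: E.
Qed.

End Component.
End RaagLength.

(** * Conjugates of minimal displacement *)

Section SubgroupProp.
Variables (G : groupType) (H : set G).
Hypothesis sH : is_subgroup H.

Lemma subgroup1 : H 1.
Proof. by case: sH; rewrite inE. Qed.

Lemma subgroupF x y : H x -> H y -> H (x / y).
Proof. by case: sH => _ HF Hx Hy; have := HF x y; rewrite !inE; apply. Qed.

Lemma subgroupV x : H x -> H x^-1.
Proof. by move=> Hx; rewrite -div1g; apply: subgroupF subgroup1 Hx. Qed.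

Lemma subgroupM x y : H x -> H y -> H (x * y).
Proof. by move=> Hx Hy; rewrite -[y]invgK; apply: subgroupF Hx (subgroupV Hy). Qed.

End SubgroupProp.

Section Reduction.
Variable Gamma : sgraph.
Let G : groupType := raag Gamma.
Implicit Types (g h x z : G) (v : Gamma).

Definition displacement (Y : seq G) x : nat := \sum_(s <- Y) len predT (x^-1 * s * x).

(** Since z0 does not cancel against the conjugate of y, which has no v-letters,
    conjugating back by z0 cannot shorten it. *)
Lemma ell_conj_shortest (v : Gamma) z0 y : 
  (forall y, ell v y = 0 -> forall u : Gamma, ell u (z0 * y) = ell u z0 + ell u y) ->
  ell v (z0^-1 * y * z0) = 0 -> forall u : Gamma, ell u (z0^-1 * y * z0) <= ell u y.
Proof.
move=> sh y0 u; have := sh _ y0 u; rewrite !mulgA mulgV mul1g => E.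
by have := tree_lengthM (tree_length_ell u) y z0; rewrite E; lia.
Qed.

(** At a conjugate of minimal displacement, a tree without loxodromic elements
    is fixed at its base point: otherwise moving to the common fixed point
    would decrease the displacement. *)
Lemma elliptic_minimal (H : set G) (Y : seq G) : is_subgroup H ->
  {in Y, forall s, H s} -> exists x, forall v,
  (exists2 h, H h & loxodromic (ell v) (x^-1 * h * x)) \/
  {in Y, forall s, ell v (x^-1 * s * x) = 0}.
Proof.
move=> sH HY.
pose Q n := `[< exists x, displacement Y x = n >].
have exQ : exists n, Q n by exists (displacement Y 1); apply/asboolP; exists 1.
case: (ex_minnP exQ) => n /asboolP[x xn] min; exists x => v.
case: (pselect (exists2 h, H h & loxodromic (ell v) (x^-1 * h * x))) => [|nl]; [by left|right].
have {}nl h : H h -> ~~ loxodromic (ell v) (x^-1 * h * x).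
  by move=> Hh; apply/negP => lox; apply: nl; exists h.
apply: contrapT => /existsNP[s1 /not_implyP[s1Y /eqP s1v]].
have lT := tree_length_ell v.
pose c s := x^-1 * s * x.
have [s0 s0Y s0max] : exists2 s0, s0 \in Y & {in Y, forall s, ell v (c s) <= ell v (c s0)}.
  elim: (Y) s1 s1Y {s1v} => // a Y' IH s1 _; case: Y' IH => [|b Y'] IH.
    by exists a; rewrite ?mem_head // => s; rewrite inE => /eqP ->.
  have [s0 s0Y s0max] := IH b (mem_head _ _).
  case: (leqP (ell v (c a)) (ell v (c s0))) => le.
    exists s0; first by rewrite inE s0Y orbT.
    by move=> s; rewrite inE => /predU1P[->//|/s0max].
  exists a; first exact: mem_head.
  move=> s; rewrite inE => /predU1P[->//|/s0max] le2.
  exact: leq_trans le2 (ltnW le).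
have s0_gt0 : 0 < ell v (c s0) by apply: leq_trans (s0max _ s1Y); rewrite lt0n.
(* The midpoint of the segment from 1 to c s0 has to be a vertex. *)
have ev : ~~ odd (ell v (c s0)).
  by apply/negP => /odd_loxodromic lox; have := nl s0 (HY _ s0Y); rewrite lox.
pose m := (ell v (c s0))./2; have m2 : ell v (c s0) = (2 * m)%N.
  by rewrite /m mul2n even_halfK.
have [z zm zs0] := @ell_prefix _ v (c s0) m ltac:(lia).
have [z0 [zz0 sh]] := shortest_representative v z.
have fix0 s : s \in Y -> ell v (z0^-1 * c s * z0) = 0.
  move=> sY; have F : ell v (z^-1 * c s * z) = 0.
    apply: (elliptic_common_fixpoint lT (s0 := c s0) (m := m)) => //.
    - exact/nl/HY.
    - exact/nl/HY.
    - have := nl (s * s0) (subgroupM sH (HY _ sY) (HY _ s0Y)).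
      by rewrite /c !mulgA mulgK.
    - by rewrite zs0; lia.
    - by rewrite -m2; apply: s0max.
  have -> : z0^-1 * c s * z0 = (z^-1 * z0)^-1 * (z^-1 * c s * z) * (z^-1 * z0).
    by rewrite invgM invgK !mulgA !mulgK.
  apply/eqP; rewrite -leqn0 (leq_trans (tree_lengthM lT _ _)) // zz0 addn0.
  by rewrite (leq_trans (tree_lengthM lT _ _)) // F (tree_lengthV lT) zz0.
have le s u : s \in Y -> ell u (z0^-1 * c s * z0) <= ell u (c s).
  by move=> sY; apply: (ell_conj_shortest sh); apply: fix0.
have : displacement Y (x * z0) < n.
  have E s : (x * z0)^-1 * s * (x * z0) = z0^-1 * c s * z0 by rewrite invgM !mulgA.
  have le' s : s \in Y -> len predT (z0^-1 * c s * z0) <= len predT (c s).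
    by move=> sY; rewrite !lenE; apply: leq_sum => u _; apply: le.
  have lt' : len predT (z0^-1 * c s0 * z0) < len predT (c s0).
    rewrite !lenE (bigD1 v) //= [X in _ < X](bigD1 v) //= fix0 //.
    by rewrite add0n -addn1 addnC; apply: leq_add => //; apply: leq_sum => u _; apply: le.
  rewrite -xn /displacement; under eq_bigr do rewrite E.
  rewrite !(big_rem s0 s0Y) /= -addSn; apply: leq_add => //.
  rewrite big_seq [X in _ <= X]big_seq; apply: leq_sum => s /mem_rem; exact: le'.
rewrite ltnNge => /negP; apply; apply: min; apply/asboolP; by exists (x * z0).
Qed.

(** Finite generation is needed for this: a group all of whose elements are
    elliptic fixes a point of the tree once it is finitely generated. *)
Lemma conj_reduction (H : set G) : is_subgroup H -> finitely_generated H ->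
  exists x, forall v, (exists2 h, H h & loxodromic (ell v) (x^-1 * h * x)) \/
  (forall h, H h -> ell v (x^-1 * h * x) = 0).
Proof.
move=> sH [Y HY].
have sub : forall s, s \in (Y : seq G) -> H s.
  by move=> s sY; rewrite HY => A [_ YA]; apply: YA.
have [x Hx] := elliptic_minimal sH sub; exists x => v.
have [|Y0] := Hx v; [by left|right=> h].
have lT := tree_length_ell v.
rewrite HY => /(_ [set h | ell v (x^-1 * h * x) = 0]); apply.
split=> [|s /= sY]; last exact: Y0.
split=> [|g h']; first by rewrite inE /= mulg1 mulVg (tree_length1 lT).
rewrite !inE /= => g0 h0.
have -> : x^-1 * (g / h') * x = (x^-1 * g * x) * (x^-1 * h' * x)^-1.
  by rewrite !invgM invgK !mulgA mulgK.
by apply/eqP; rewrite -leqn0 (leq_trans (tree_lengthM lT _ _)) // (tree_lengthV lT) g0 h0.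
Qed.

End Reduction.

(** * Ping-pong in all trees at once *)

Section Main.
Variable Gamma : sgraph.
Let G : groupType := raag Gamma.
Local Notation adj := (@adj Gamma).
Variables (K : G -> Prop) (L : pred Gamma).
Hypotheses (K1 : K 1) (KM : forall x y, K x -> K y -> K (x * y))
  (KV : forall x, K x -> K x^-1).
Hypothesis KL : forall x, K x -> supported L x.

Let lT v : tree_length (@ell Gamma v) := tree_length_ell v.

Section Axis.
Variable t : G.
Hypotheses (Kt : K t) (tl : forall v, L v -> loxodromic (ell v) t).

Definition nonadjacent u v := [&& L u, L v & ~~ adj u v].

Lemma same_end_connect (x : G) u v : L v -> connect nonadjacent v u ->
  same_end (ell v) (ray x t) (ray 1 t) -> same_end (ell u) (ray x t) (ray 1 t).
Proof.
move=> Lv /connectP[p pth ->] {u}; elim: p v Lv pth => //= u p IH v Lv.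
case/andP=> /and3P[_ Lu nvu] pth cv; apply: IH => //.
have [->//|vu] := eqVneq u v.
apply: (same_end_transfer (lT v) (lT u) _ (tl Lv) (tl Lu) (tl Lv) (tl Lu) cv).
by apply: tree_length_pair => //; rewrite eq_sym.
Qed.

(** If h fixes the attracting end of t in the v-tree, it does so in the tree of
    each vertex of the component of v in the complement of the graph. In these
    trees the conjugates t ^- n * h * t ^+ n stay bounded, so two of them agree
    up to letters outside the component. Up to such letters, which commute with
    the component, h then commutes with a power of t, and hence it fixes the
    repelling end as well. *)
Lemma fixed_end_opposite h v : K h -> L v ->
  same_end (ell v) (ray h t) (ray 1 t) ->
  same_end (ell v) (ray h t^-1) (ray 1 t^-1).
Proof.
move=> Kh Lv cv; pose D := connect nonadjacent v.
have DL u : D u -> L u.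
  move=> /connectP[p pth ->]; elim: p (v) Lv pth => //= a p IH b _.
  by case/andP=> /and3P[_ La _]; apply: IH.
have LD x y : L x -> ~~ D x -> D y -> adj x y.
  move=> Lx nDx Dy; apply: contraR nDx => nxy.
  apply: (connect_trans Dy); apply: connect1.
  by rewrite /nonadjacent (DL _ Dy) Lx adj_sym nxy.
have Dv : D v by apply: connect0.
pose c n := t ^- n * h * t ^+ n.
have Kc n : K (c n) by apply: KM; [apply: KM => //; apply: KV|]; apply: (closed_expg K1 KM).
pose B := \sum_(u | D u) (axis_gap (ell u) t + 3 * ell u h).
have cB n : len D (c n) <= B.
  rewrite lenE; apply: leq_sum => u Du; apply: (same_end_conj_bound (lT u)).
    exact: tl (DL _ Du).
  exact: same_end_connect Lv Du cv.
have [n [m [nm z0]]] := len_pigeonhole LD (fun k => KL (Kc k)) cB.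
pose k := m - n; pose T := t ^+ k; pose y j := T ^+ j * c n * T ^- j.
set z := (c n)^-1 * c m in z0.
have KT j : K (T ^+ j) by do 2 apply: (closed_expg K1 KM).
(* Elements of D-length zero form a normal subgroup modulo which T commutes
   with c n; so the conjugates y j by powers of T stay bounded too. *)
have cm : T^-1 * c n * T = c n * z.
  rewrite /z mulVKg /c /T -(subnK (ltnW nm)) -/k expgnDr invgM -!mulgA.
  rewrite -expgnDr [(k + n)%N]addnC expgnDr.
  by rewrite !mulgA -!invgM -!expgnDr (addnC n).
have yB j : len D (y j) <= B.
  elim: j => [|j IH]; first by rewrite /y expg0 mul1g invg1 mulg1.
  have E : y j = y j.+1 * (T ^+ j.+1 * z * T ^- j.+1).
    have AT : T ^+ j.+1 * T^-1 = T ^+ j by rewrite expgSr mulgK.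
    have -> : y j.+1 * (T ^+ j.+1 * z * T ^- j.+1) =
        T ^+ j.+1 * (c n * z) * T ^- j.+1 by rewrite /y !mulgA mulgVK.
    have -> : T ^+ j.+1 * (c n * z) * T ^- j.+1 =
        (T ^+ j.+1 * T^-1) * c n * (T ^+ j.+1 * T^-1)^-1.
      by rewrite -cm invgM invgK !mulgA.
    by rewrite AT.
  have E2 : y j.+1 = y j * (T ^+ j.+1 * z * T ^- j.+1)^-1 by rewrite E mulgK.
  rewrite E2 (leq_trans (lenM _ _ _)) // lenV.
  have := len0_conj LD (KL (KV (KT j.+1))) _ z0; rewrite invgK => ->.
    by rewrite addn0.
  by apply: KL; apply: KM; [apply: KV|].
have tlv := tl Lv; have tlv' : loxodromic (ell v) t^-1 by rewrite (loxodromicV (lT v)).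
apply: (quasi_ray_unbounded (lT v)); do ?exact: quasi_ray_ray.
move=> K0; pose j := K0 + B + n; pose i := j * k - n.
have k0 : 0 < k by rewrite subn_gt0.
have le_nj : n <= j * k by rewrite /j; nia.
exists i, i; rewrite /ray mul1g !expVgn.
have yE : y j = t ^+ i * h * t ^- i.
  rewrite /y /T -expgnA mulnC -(subnK le_nj) -/i /c expgnDr invgM !mulgA.
  by rewrite !mulgK.
have E := overlapE (lT v) (h * t ^- i) (t ^- i).
have yV : (h * t ^- i)^-1 * t ^- i = (y j)^-1 by rewrite yE !invgM invgK mulgA.
rewrite yV (tree_lengthV (lT v)) in E.
have ly : ell v (y j) <= B.
  by apply: leq_trans (yB j); rewrite lenE (bigD1 v) //= leq_addr.
have li : i <= ell v (t ^- i).
  by rewrite (tree_lengthV (lT v)); exact: (length_loxX_ge (lT v)).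
have le_i : K0 + B <= i by rewrite /i /j; nia.
by move: E; tree_lia (ell v).
Qed.


End Axis.

Lemma uniform_bound (T : finType) (P : T -> nat -> Prop) :
  (forall x B B', B <= B' -> P x B -> P x B') ->
  (forall x, exists B, P x B) -> exists B, forall x, P x B.
Proof.
move=> mono /choice[f fP]; exists (\max_x f x) => x.
by apply: mono (fP x); apply: leq_bigmax.
Qed.

Section PingPong.
Variable t : G.
Hypotheses (Kt : K t) (tl : forall v, L v -> loxodromic (ell v) t).

(** For v in L, its elements in K fix the repelling end of t as well
    (end_stabilizer_opposite). *)
Definition end_stabilizer v x := same_end (ell v) (ray x t) (ray 1 t).

Lemma end_stabilizerM v x y :
  end_stabilizer v x -> end_stabilizer v y -> end_stabilizer v (x * y).
Proof.
move=> Ex Ey; apply: (same_end_trans (lT v) _ Ex).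
by have := same_end_ray_mull (lT v) x Ey; rewrite mulg1.
Qed.

Lemma end_stabilizerV v x : end_stabilizer v x -> end_stabilizer v x^-1.
Proof.
move=> Ex; apply: (same_end_sym (lT v)).
by have := same_end_ray_mull (lT v) x^-1 Ex; rewrite mulVg mulg1.
Qed.

Let tlV v : L v -> loxodromic (ell v) t^-1.
Proof. by move=> Lv; rewrite (loxodromicV (lT v)); apply: tl. Qed.

Lemma end_stabilizer_opposite v x : L v -> K x ->
  same_end (ell v) (ray x t^-1) (ray 1 t^-1) <-> end_stabilizer v x.
Proof.
move=> Lv Kx; split=> cv; last exact: fixed_end_opposite.
by have := fixed_end_opposite (KV Kt) tlV Kx Lv cv; rewrite invgK.
Qed.

(** Labels and length locate the elements of K in the v-tree up to a bounded
    error. *)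
Definition tame v (lab : G -> nat) C := forall g h, K g -> K h ->
  lab g = lab h -> ell v g = ell v h -> ell v (g^-1 * h) <= C.

(** If finitely many cosets of the stabilizer of the ends of t cover K, every
    element of K is near one of finitely many rays, and its length locates it
    on that ray. *)
Lemma finite_index_tame v : L v -> ~ infinite_index K end_stabilizer v ->
  exists r lab C, (forall g, lab g < r) /\ tame v lab C.
Proof.
move=> Lv /existsNP[xs /not_implyP[Kxs cover]].
have {}cover y : K y -> exists2 x, x \in xs & end_stabilizer v (x^-1 * y).
  move=> Ky; apply: contrapT => no; apply: cover; exists y => // x xX Ex.
  by apply: no; exists x.
have tv := tl Lv; pose u n := if odd n then t else t^-1.
(* The label n encodes the coset representative of index n./2 and, by its
   parity, the choice between the two rays of the axis of t. *)
pose near n g := exists N0, forall N, N0 <= N ->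
  2 * ell v ((nth 1 xs n./2)^-1 * g) <=
  overlap (ell v) ((nth 1 xs n./2)^-1 * g) (u n ^+ N) + axis_gap (ell v) t.
have label g : exists n, n < (2 * size xs).+2 /\ (K g -> near n g /\ n./2 < size xs).
  case: (pselect (K g)) => [Kg|nK]; last by exists 0.
  have [x xX Ex] := cover g Kg.
  have Ke : K (x^-1 * g) by apply: KM => //; apply: KV; apply: Kxs.
  have [b [N0 HN]] := near_axis (lT v) tv Ex (fixed_end_opposite Kt tl Ke Lv Ex).
  have ix : index x xs < size xs by rewrite index_mem.
  exists (b + (index x xs).*2); split; first by move: (index x xs) ix => i; case: (b) => /=; lia.
  have h2 : (b + (index x xs).*2)./2 = index x xs by rewrite half_bit_double.
  move=> _; split; last by rewrite h2.
  exists N0 => N /HN; rewrite h2 nth_index // /u oddD odd_double addbF.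
  by case: (b).
have {label}[lab labP] := choice label.
exists (2 * size xs).+2, lab, (axis_gap (ell v) t + 2 * \sum_(x <- xs) ell v x).
split=> [g|g h Kg Kh gh lgh]; first by have [] := labP g.
have [[N1 H1] ix] := (labP g).2 Kg; have [[N2 H2] _] := (labP h).2 Kh.
rewrite -gh in H2; set x := nth 1 xs _ in H1 H2.
have {}H1 := H1 (N1 + N2) ltac:(lia); have {}H2 := H2 (N1 + N2) ltac:(lia).
have := near_same_ray (lT v) H1 H2.
rewrite invgM invgK -mulgA mulVKg => D.
have xs_x : ell v x <= \sum_(y <- xs) ell v y.
  by rewrite (big_rem x) ?mem_nth //= leq_addr.
have A1 := length_triangle (lT v) g x; have A2 := length_triangle (lT v) h x.
have A3 := tree_lengthM (lT v) x^-1 g; have A4 := tree_lengthM (lT v) x^-1 h.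
rewrite (tree_lengthV (lT v)) in A3 A4.
by move: D; tree_lia (ell v).
Qed.

(** The trees in which ping-pong is possible, and needed. *)
Definition wild v := L v /\ infinite_index K end_stabilizer v.

(** With more pairwise independent loxodromic elements than there are trees
    and sides, one of them lies between g and h without much cancellation
    in every tree: for each tree and side at most one of them fails. *)
Lemma ping_pong : exists (F : seq G) C, {in F, forall f, K f} /\
  forall g h, K g -> K h -> exists2 f, f \in F &
  forall v, wild v -> 2 * ell v g <= overlap (ell v) g (g * f * h) + C.
Proof.
pose s := [seq v <- enum Gamma | `[< wild v >]].
have sP v : v \in s <-> wild v.
  by rewrite mem_filter mem_enum andbT; split=> /asboolP.
have inf : {in s, forall v, infinite_index K end_stabilizer v} by move=> v /sP[].
pose N := (2 * #|Gamma|).+1.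
have [f [Kf Hf]] := distinct_cosets K1 KM KV end_stabilizerM end_stabilizerV inf N.
pose bounded (x : Gamma * 'I_N * 'I_N) B := forall n, x.1.1 \in s -> x.1.2 < x.2 ->
  overlap (ell x.1.1) (f x.2 * t ^+ n) (f x.1.2 * t ^+ n) <= B /\
  overlap (ell x.1.1) (f x.2 * t ^- n) (f x.1.2 * t ^- n) <= B.
have [B HB] : exists B, forall x, bounded x B.
  apply: uniform_bound => [x B B' BB' HB n xs lt|[[v j] k]].
    by have [? ?] := HB n xs lt; split; lia.
  case: (boolP ((v \in s) && (j < k))) => [/andP[vs jk]|nvs]; last first.
    by exists 0 => n /= vs jk; rewrite vs jk in nvs.
  have Lv : L v by have [] := (sP v).1 vs.
  have nE := Hf v vs j k jk (ltn_ord k).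
  have sep u : ~ same_end (ell v) (ray ((f j)^-1 * f k) u) (ray 1 u) ->
      ~ same_end (ell v) (ray (f k) u) (ray (f j) u).
    by move=> nc /(same_end_ray_mull (lT v) (f j)^-1); rewrite mulVg.
  have [B1 HB1] := ray_dichotomy (lT v) (tl Lv) (tl Lv) (sep t nE).
  have nE' : ~ same_end (ell v) (ray ((f j)^-1 * f k) t^-1) (ray 1 t^-1).
    by move/(end_stabilizer_opposite Lv (KM (KV (Kf j)) (Kf k))).
  have [B2 HB2] := ray_dichotomy (lT v) (tlV Lv) (tlV Lv) (sep t^-1 nE').
  exists (B1 + B2) => n _ _ /=; have := HB1 n n; have := HB2 n n.
  by rewrite /ray !expVgn; tree_lia (ell v).
pose R := \sum_(i < N) len predT (f i).
have fR v (i : 'I_N) : ell v (f i) <= R.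
  rewrite /R (bigD1 i) //= (leq_trans _ (leq_addr _ _)) // lenE.
  by rewrite (bigD1 v) //= leq_addr.
(* C bounds the overlaps of the w i whatever the exponent M is, which is then
   chosen to make each w i longer than C. *)
pose C := B + 4 * R; pose M := (C + 2 * R).+1.
pose w (i : 'I_N) := f i * t ^+ M * (f i)^-1.
have wV i : (w i)^-1 = f i * t ^- M * (f i)^-1 by rewrite /w !invgM invgK mulgA.
have Kw i : K (w i).
  by apply: KM; [apply: KM => //; apply: (closed_expg K1 KM)|apply: KV].
have short v (i j : 'I_N) (x : G) :
    overlap (ell v) (f j * x) (f i * x) <= B ->
    overlap (ell v) (f i * x * (f i)^-1) (f j * x * (f j)^-1) <= C.
  have := overlap_mulr (lT v) (f i * x) (f j * x * (f j)^-1) (f i)^-1.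
  have := overlap_mulr (lT v) (f j * x) (f i * x) (f j)^-1.
  rewrite (overlapC (lT v) (f j * x / f j)) !(tree_lengthV (lT v)).
  have := fR v i; have := fR v j; rewrite /C; tree_lia (ell v).
have sepw v (i j : 'I_N) : v \in s -> i < j ->
    overlap (ell v) (w i) (w j) <= C /\ overlap (ell v) (w i)^-1 (w j)^-1 <= C.
  move=> vs ij; have [H1 H2] := HB (v, i, j) M vs ij.
  by rewrite !wV; split; apply: short.
exists [seq w i | i : 'I_N], C; split=> [_ /mapP[i _ ->] //|g h Kg Kh].
suff [i Hi] : exists i, forall v, v \in s ->
    overlap (ell v) g^-1 (w i) <= C /\ overlap (ell v) (w i)^-1 h <= C.
  exists (w i) => [|v /[dup] [[Lv _]] /sP vs]; first by apply/mapP; exists i; rewrite ?mem_enum.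
  have [H1 H2] := Hi v vs; apply: (overlap_concat (lT v) H1 H2).
  have := length_triangle (lT v) (t ^+ M) (f i)^-1; rewrite invgK.
  have := length_triangleV (lT v) (f i * t ^+ M) (w i).
  have -> : (f i * t ^+ M)^-1 * w i = (f i)^-1 by rewrite /w mulKg.
  have := length_loxX_ge (lT v) M (tl Lv); have := fR v i.
  by rewrite !(tree_lengthV (lT v)) /M; tree_lia (ell v).
apply: contrapT => /forallNP none.
pose bad (i : 'I_N) (p : Gamma * bool) := p.1 \in s /\
  C < (if p.2 then overlap (ell p.1) g^-1 (w i) else overlap (ell p.1) (w i)^-1 h).
have ex_bad i : exists p, bad i p.
  have /existsNP[v /not_implyP[vs /not_andP[] /negP]] := none i;
    rewrite -ltnNge => lt; by [exists (v, true)|exists (v, false)].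
have [p pP] := choice ex_bad.
(* Two elements w i and w j failing for the same tree and side would both
   overlap g^-1, or h, and hence each other, in more than C. *)
have : injective p.
  have half (i j : 'I_N) : i < j -> p i = p j -> False.
    move=> ij pij; have [vs H1] := pP i; have [_ H2] := pP j; rewrite -pij in H2.
    have [S1 S2] := sepw _ _ _ vs ij; move: H1 H2; case: (p i).2 => H1 H2.
      have := overlap_ultra (lT (p i).1) (w i) (w j) g^-1.
      by rewrite (overlapC (lT _) (w i)); lia.
    have := overlap_ultra (lT (p i).1) (w i)^-1 (w j)^-1 h.
    by rewrite (overlapC (lT _) h); lia.
  move=> i j pij; have [/half/(_ pij)//|lt|/val_inj//] := ltngtP i j.
  by case: (half _ _ lt (esym pij)).
by move/leq_card; rewrite card_ord card_prod card_bool /N; lia.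
Qed.

(** In a wild tree the product u locates g, which lies near the segment from 1
    to u; in the other trees the label of g does. *)
Lemma separation_axis : exists (F : seq G) (lab : Gamma -> G -> nat) r C (good : G -> G -> Prop),
  [/\ {in F, forall f, K f}, forall v g, lab v g < r,
    forall g h, K g -> K h -> exists2 f, f \in F & good g (g * f * h) &
    forall g h u, K g -> K h -> good g u -> good h u ->
      (forall v, lab v g = lab v h /\ ell v g = ell v h) ->
      forall v, ell v (g^-1 * h) <= C].
Proof.
have [F [C1 [KF HF]]] := ping_pong.
have tame_or_wild v : exists x : nat * (G -> nat) * nat,
    (forall g, x.1.2 g < x.1.1) /\ (wild v \/ tame v x.1.2 x.2).
  case: (boolP (L v)) => Lv; last first.
    exists (1%N, fun=> 0, 0); split=> //; right=> g h Kg Kh _ _.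
    by rewrite (supportedM (supportedV (KL Kg)) (KL Kh) Lv).
  case: (pselect (infinite_index K end_stabilizer v)) => [iv|fv].
    by exists (1%N, fun=> 0, 0); split=> //; left.
  by have [r [lab [C [? ?]]]] := finite_index_tame Lv fv; exists (r, lab, C); split; [|right].
have {tame_or_wild}[x xP] := choice tame_or_wild.
pose good g u := forall v, wild v -> 2 * ell v g <= overlap (ell v) g u + C1.
exists F, (fun v => (x v).1.2), (\max_v (x v).1.1), (C1 + \max_v (x v).2), good.
split=> //.
  by move=> v g; apply: leq_trans ((xP v).1 g) (leq_bigmax v).
move=> g h u Kg Kh gu hu same v; have [labv lv] := same v.
have [wv|tv] := (xP v).2; last first.
  by apply: leq_trans (tv g h Kg Kh labv lv) (leq_trans (leq_bigmax v) (leq_addl _ _)).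
have := gu v wv; have := hu v wv; have E := overlapE (lT v) g h.
have := overlap_ultra (lT v) g h u; rewrite (overlapC (lT v) u); tree_lia (ell v).
Qed.

End PingPong.

Lemma separation : (forall v, L v -> exists2 h, K h & loxodromic (ell v) h) ->
  exists (F : seq G) (lab : Gamma -> G -> nat) r C (good : G -> G -> Prop),
  [/\ {in F, forall f, K f}, forall v g, lab v g < r,
    forall g h, K g -> K h -> exists2 f, f \in F & good g (g * f * h) &
    forall g h u, K g -> K h -> good g u -> good h u ->
      (forall v, lab v g = lab v h /\ ell v g = ell v h) ->
      forall v, ell v (g^-1 * h) <= C].
Proof.
move=> lox; have [v|t Kt tl] := simultaneous_loxodromic lT K1 KM (s := enum L).
  by rewrite mem_enum; apply: lox.
by apply: (separation_axis Kt) => v Lv; apply: tl; rewrite mem_enum.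
Qed.

End Main.

(** * A limit of roots *)

Section Fekete.
Local Open Scope ring_scope.
Variable R : realType.
Implicit Types (a phi : nat -> R).

Definition sublinear phi := forall e : R, 0 < e ->
  exists C, forall n, phi n <= e * n%:R + C.

(** The limit is the supremum L of u n := (a n - phi n) / (n + c). By definition
    a n <= L * (n + c) + phi n; conversely, iterating the superadditivity along
    the multiples of n0 + c gives a N >= u n0 * N up to a constant. *)
Lemma fekete_shift a phi c (q : R) : (0 < c)%N ->
  (forall n, 0 <= a n) -> {homo a : n m / (n <= m)%N >-> n <= m} ->
  (forall n, a n <= q * n%:R) -> (forall n, 0 <= phi n) -> sublinear phi ->
  (forall n m, a n + a m <= phi n + a (n + m + c)%N) ->
  cvgn (fun n => a n / n%:R).
Proof.
move=> c0 a0 amono aq phi0 subl super.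
pose u n := (a n - phi n) / (n + c)%:R.
have pc n : 0 < (n + c)%:R :> R by rewrite ltr0n addn_gt0 c0 orbT.
have q0 : 0 <= q by have := aq 1%N; rewrite mulr1; apply: le_trans.
have ub : has_ubound (range u).
  exists q => _ [n _ <-]; rewrite ler_pdivrMr //.
  apply: le_trans (_ : a n <= _); first by rewrite gerBl.
  by apply: le_trans (aq n) _; rewrite ler_wpM2l // ler_nat leq_addr.
pose L := sup (range u).
have uL n : u n <= L by apply: ub_le_sup => //; exists n.
have upper n : a n <= L * (n + c)%:R + phi n.
  by have := uL n; rewrite ler_pdivrMr // lerBlDr.
have lower n k : k%:R * (a n - phi n) <= a (k * (n + c))%N.
  elim: k => [|k IH]; first by rewrite mul0r.
  have := super n (k * (n + c))%N.
  have -> : (n + k * (n + c) + c = k.+1 * (n + c))%N by rewrite mulSn addnAC.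
  by rewrite -natr1 mulrDl mul1r; lra.
apply/cvg_ex; exists L; apply/cvgrPdist_le => e e0.
have e2 : 0 < e / 2 by rewrite divr_gt0.
have sup_u : has_sup (range u) by split=> //; exists (u 0%N), 0%N.
have [_ [n0 _ <-] un0] := sup_adherent e2 sup_u.
rewrite -/L in un0.
have [C HC] := subl _ e2.
pose p := (n0 + c)%:R : R.
pose B := `|L| * c%:R + `|C| + p * `|u n0|.
have [n1 Hn1] : exists n1 : nat, B <= e / 2 * n1%:R.
  exists (Num.truncn (B / (e / 2))).+1.
  by rewrite mulrC -ler_pdivrMr // ltW // truncnS_gt.
exists n1.+1 => // N /= le_N.
have N0 : 0 < N%:R :> R by rewrite ltr0n (leq_ltn_trans _ le_N).
have BN : B <= e / 2 * N%:R.
  by apply: le_trans Hn1 _; rewrite ler_wpM2l ?(ltW e2) // ler_nat ltnW.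
have Lc : L * c%:R <= `|L| * c%:R by rewrite ler_wpM2r // ler_norm.
have Lc0 : 0 <= `|L| * c%:R by rewrite mulr_ge0.
have CC := ler_norm C; have C0 := normr_ge0 C.
have pu0 : 0 <= p * `|u n0| by rewrite mulr_ge0 // ltW // pc.
have up : a N <= (L + e) * N%:R.
  have := upper N; have := HC N; rewrite natrD /B in BN *; rewrite mulrDr mulrDl.
  have : e * N%:R = e / 2 * N%:R + e / 2 * N%:R by rewrite -mulrDl -splitr.
  by lra.
have lo : (L - e) * N%:R <= a N.
  have pE : u n0 * p = a n0 - phi n0 by rewrite /u divfK // gt_eqF // pc.
  have := lower n0 (N %/ (n0 + c))%N; rewrite -pE.
  have := amono _ _ (leq_divM N (n0 + c)).
  have E : N%:R = (N %/ (n0 + c))%:R * p + (N %% (n0 + c))%:R.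
    by rewrite /p -natrM -natrD -divn_eq.
  have md : (N %% (n0 + c))%:R <= p by rewrite /p ler_nat ltnW // ltn_mod addn_gt0 c0 orbT.
  have md0 : 0 <= (N %% (n0 + c))%:R :> R by [].
  move: (N %% _)%:R (N %/ _)%:R E md md0 => r k E md md0 A1 A2.
  have ru : r * u n0 <= p * `|u n0|.
    by apply: le_trans (ler_wpM2l md0 (ler_norm _)) _; rewrite ler_wpM2r.
  have uN : (L - e / 2) * N%:R <= u n0 * N%:R by rewrite ler_pM2r // ltW.
  have eN : e * N%:R = e / 2 * N%:R + e / 2 * N%:R by rewrite -mulrDl -splitr.
  have uE : u n0 * N%:R = k * (u n0 * p) + r * u n0 by rewrite E; ring.
  rewrite mulrBl in uN *; rewrite /B in BN.
  by lra.
rewrite distrC ler_distl; apply/andP; split.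
  by rewrite ler_pdivlMr.
by rewrite ler_pdivrMr.
Qed.

Lemma sublinear_ln_poly (A D : nat) : (0 < A)%N ->
  sublinear (fun n => ln ((A * n.+1 ^ D)%:R : R)).
Proof.
move=> A0 e e0; pose eta := e / D.+1%:R.
have eta0 : 0 < eta by rewrite divr_gt0.
exists (ln (A%:R : R) + D%:R * (eta - ln eta)) => n.
rewrite natrM natrX lnM ?posrE ?exprn_gt0 ?ltr0n //.
rewrite lnXn ?ltr0n // -mulr_natl.
(* ln x < x at x = eta * n.+1 *)
have ln_le : ln (n.+1%:R : R) <= eta * n.+1%:R - ln eta.
  have := @ln_sublinear R (eta * n.+1%:R) (mulr_gt0 eta0 (ltr0Sn _ _)).
  by rewrite lnM ?posrE ?ltr0n //; lra.
have D0 : 0 <= D%:R :> R by [].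
have H := ler_wpM2l D0 ln_le.
have De : D%:R * eta <= e.
  by rewrite /eta mulrCA ler_piMr ?(ltW e0) // ler_pdivrMr // mul1r ler_nat.
have H2 := ler_wpM2r (ler0n R n) De.
have E : D%:R * (eta * n.+1%:R - ln eta) =
    D%:R * eta * n%:R + D%:R * (eta - ln eta) by rewrite -[n.+1%:R]natr1; ring.
rewrite E in H.
lra.
Qed.

(** Supermultiplicativity up to a polynomial factor and a shift suffices, since
    the logarithm of a polynomial is sublinear. *)
Lemma growth_rate_exists (b : nat -> nat) (A D c q : nat) :
  (forall n, 0 < b n)%N -> {homo b : n m / (n <= m)%N} ->
  (forall n, b n <= q ^ n)%N ->
  (forall n m, b n * b m <= A * n.+1 ^ D * b (n + m + c))%N ->
  cvgn (fun n => (b n)%:R `^ n%:R^-1 : R).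
Proof.
move=> b0 bmono bq super.
have A0 : (0 < A)%N.
  have := super 0%N 0%N; case: (A) => //; rewrite !mul0n.
  by rewrite leqNgt muln_gt0 !b0.
pose a n := ln ((b n)%:R : R).
have br n : 0 < (b n)%:R :> R by rewrite ltr0n.
have q0 : (0 < q)%N by have := leq_trans (b0 1%N) (bq 1%N); rewrite expn1.
have -> : (fun n => (b n)%:R `^ n%:R^-1 : R) = (fun n => expR (a n / n%:R)).
  by apply/funext => n; rewrite /powR gt_eqF // mulrC.
have : cvgn (fun n => a n / n%:R).
  apply: (@fekete_shift a (fun n => ln ((A * n.+1 ^ D)%:R : R)) c.+1 (ln q%:R)) => //.
  - by move=> n; rewrite ln_ge0 // ler1n.
  - by move=> n m nm; rewrite ler_ln ?posrE // ler_nat bmono.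
  - move=> n; rewrite mulr_natr -lnXn ?ltr0n // ler_ln ?posrE ?exprn_gt0 ?ltr0n //.
    by rewrite -natrX ler_nat.
  - by move=> n; rewrite ln_ge0 // ler1n muln_gt0 A0 expn_gt0.
  - exact: sublinear_ln_poly.
  move=> n m; rewrite -!lnM ?posrE ?ltr0n ?muln_gt0 ?A0 ?expn_gt0 //.
  rewrite -!natrM ler_ln ?posrE ?ltr0n ?muln_gt0 ?A0 ?expn_gt0 ?b0 //.
  rewrite ler_nat (leq_trans (super n m)) // leq_mul2l bmono ?orbT //.
  by rewrite leq_add2l.
move=> /cvg_ex[l al]; apply/cvg_ex; exists (expR l).
by apply: continuous_cvg al; apply: continuous_expR.
Qed.

End Fekete.

(** * Growth of balls *)

Section WordLength.
Variables (G : groupType) (X : {fset G}).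
Hypothesis genX : generating X.
Implicit Types g h : G.

Lemma word_length1 : word_length X 1 = 0.
Proof.
apply/eqP; rewrite -leqn0; apply: word_length_min; exists [::].
by split=> //; rewrite big_nil.
Qed.

Lemma word_lengthM g h : word_length X (g * h) <= word_length X g + word_length X h.
Proof.
have [u [su uX uE]] := word_length_exists g genX.
have [w [sw wX wE]] := word_length_exists h genX.
rewrite -su -sw -size_cat; apply: word_length_min; exists (u ++ w).
by split=> [//|x|]; rewrite ?big_cat ?uE ?wE // mem_cat => /orP[/uX|/wX].
Qed.

Lemma length_le_word_length (l : G -> nat) : l 1 = 0 ->
  (forall g, l g^-1 = l g) -> (forall g h, l (g * h) <= l g + l h) ->
  forall g, l g <= (\sum_(x <- X) l x) * word_length X g.
Proof.
move=> l1 lV lM g; have [w [<- wX {1}<-]] := word_length_exists g genX.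
elim: w wX => [|x w IH] wX; first by rewrite big_nil l1.
rewrite big_cons mulnS (leq_trans (lM _ _)) // leq_add //; last first.
  by apply: IH => y yw; apply: wX; rewrite inE yw orbT.
have le y : y \in X -> l y <= \sum_(x <- X) l x.
  by move=> yX; rewrite (big_rem y) //= leq_addr.
by case: (wX x (mem_head _ _)) => [/le//|/le]; rewrite lV.
Qed.

Section Ball.
Variable H : set G.
Let ball n := fset_set (rel_ball X H n).

Lemma mem_ball n g : (g \in ball n) = `[< H g /\ word_length X g <= n >].
Proof.
rewrite in_fset_set; last exact: finite_rel_ball.
by apply/idP/asboolP; rewrite inE.
Qed.

Lemma rel_growth_gt0 n : H 1 -> 0 < rel_growth X H n.
Proof.
move=> H1; rewrite /rel_growth cardfs_gt0; apply/fset0Pn; exists 1.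
by rewrite mem_ball; apply/asboolP; rewrite word_length1.
Qed.

Lemma rel_growth_homo : {homo rel_growth X H : n m / n <= m}.
Proof.
move=> n m nm; apply: fsubset_leq_card; apply/fsubsetP => g.
rewrite !mem_ball => /asboolP[Hg gn]; apply/asboolP; split=> //.
exact: leq_trans gn nm.
Qed.

(** Adding 1 to the generators, each element of the ball of radius n is a
    product of exactly n of the 2 * size X + 1 letters. *)
Lemma rel_growth_expn n : (rel_growth X H n <= (2 * size X).+1 ^ n)%N.
Proof.
pose S : seq G := 1 :: X ++ [seq x^-1 | x <- X].
have szS : size S = (2 * size X).+1 by rewrite /= size_cat size_map mul2n addnn.
pose P := fix P n := if n is n'.+1 then [seq x * y | x <- S, y <- P n'] else [:: 1 : G].
have szP k : size (P k) = ((2 * size X).+1 ^ k)%N.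
  elim: k => // k IH; have -> : P k.+1 = [seq x * y | x <- S, y <- P k] by [].
  by rewrite (size_allpairs (fun x y : G => x * y)) IH szS expnS.
rewrite -szP; apply: uniq_leq_size; first exact: fset_uniq.
move=> g; rewrite mem_ball => /asboolP[_].
have [w [<- wX <-]] := word_length_exists g genX.
elim: w n wX => [|x w IH] n wX le_n.
  rewrite big_nil; elim: n {le_n} => [|n IH]; first by rewrite mem_head.
  by apply/allpairsP; exists (1, 1); rewrite /= mem_head mulg1.
case: n le_n => // n le_n; rewrite big_cons; apply/allpairsP.
exists (x, \prod_(y <- w) y); split=> //=; last first.
  by apply: IH => // y yw; apply: wX; rewrite inE yw orbT.
rewrite inE mem_cat; have [->|xX] := wX x (mem_head _ _); first by rewrite orbT.
by rewrite -[x]invgK map_f ?orbT // .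
Qed.

End Ball.
End WordLength.

Section Counting.
Variable Gamma : sgraph.
Let G : groupType := raag Gamma.
Variables (X : {fset G}) (H : set G).
Hypotheses (genX : generating X) (sH : is_subgroup H).

(** Map (g, h) to the product u = g * f * h, with f in the finite set of the
    separation lemma. For given u and f, the pair is determined by g; and g is
    determined, up to a bounded number of choices, by its labels and by its
    lengths in the trees, which are linearly bounded. *)
Lemma rel_growth_supermul : finitely_generated H -> exists A D c, forall n m,
  (rel_growth X H n * rel_growth X H m <=
   A * n.+1 ^ D * rel_growth X H (n + m + c))%N.
Proof.
move=> fgH; have [x Hx] := conj_reduction sH fgH.
pose cj g := x^-1 * g * x.
pose L v := `[< exists2 h, H h & loxodromic (@ell Gamma v) (cj h) >].
pose K y := H (x * y * x^-1).
have cjK y : cj (x * y * x^-1) = y by rewrite /cj !mulgA mulgVK mulVg mul1g.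
have cjM g h : cj (g * h) = cj g * cj h by rewrite /cj !mulgA mulgK.
have cjV g : cj g^-1 = (cj g)^-1 by rewrite /cj !invgM invgK mulgA.
have Kcj g : H g -> K (cj g).
  by rewrite /K /cj !mulgA mulgV mul1g mulgK.
have K1 : K 1 by rewrite /K mulg1 mulgV; exact: subgroup1.
have KM g h : K g -> K h -> K (g * h).
  by move=> Kg Kh; have := subgroupM sH Kg Kh; rewrite /K !mulgA mulgVK.
have KV g : K g -> K g^-1.
  by move=> Kg; have := subgroupV sH Kg; rewrite /K !invgM invgK mulgA.
have KL g : K g -> supported L g.
  move=> Kg v /asboolP Lv; have [//|H0] := Hx v.
  by have := H0 _ Kg; rewrite -/(cj _) cjK.
have Klox v : L v -> exists2 h, K h & loxodromic (@ell Gamma v) h.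
  by move=> /asboolP[h Hh lox]; exists (cj h) => //; apply: Kcj.
have [F [lab [r [C [good [KF lab_lt HF Hgood]]]]]] := separation K1 KM KV KL Klox.
have [S HS] := @ell_bounded_finite Gamma C.
pose up f := x * f * x^-1.
pose c := \sum_(f <- F) word_length X (up f).
pose lam := \sum_(s <- X) @len Gamma predT s.
pose c0 := (2 * @len Gamma predT x)%N.
have ell_cj v g n : word_length X g <= n -> ell v (cj g) <= lam * n + c0.
  move=> gn; apply: leq_trans (_ : len predT (cj g) <= _).
    by rewrite lenE (bigD1 v) //= leq_addr.
  have := length_le_word_length genX (len1 predT) (lenV predT) (lenM predT) g.
  rewrite -/lam => gl; rewrite (leq_trans (lenM _ _ _)) //.
  rewrite (leq_trans (leq_add (lenM _ _ _) (leqnn _))) // lenV.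
  have : lam * word_length X g <= lam * n by rewrite leq_mul2l gn orbT.
  by move: gl; rewrite /c0; lia.
pose sig g v := (lab v (cj g), ell v (cj g)).
have mid (p : G * G) : exists k, H p.1 -> H p.2 ->
    k < size F /\ good (cj p.1) (cj (p.1 * up (nth 1 F k) * p.2)).
  case: p => g h /=.
  case: (pselect (H g /\ H h)) => [[Hg Hh]|nH]; last by exists 0 => Hg Hh; case: nH.
  have [f fF gf] := HF _ _ (Kcj _ Hg) (Kcj _ Hh).
  by exists (index f F) => _ _; rewrite index_mem fF nth_index // cjM cjM /up cjK.
have {mid}[i iP] := choice mid.
(* W key g: g is a candidate for the first factor, given the product and the
   labels and lengths; all candidates lie in a translate of the finite set S
   by one of them, base key. *)
pose W (key : G * (Gamma -> nat * nat)) g :=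
  [/\ H g, good (cj g) (cj key.1) & forall v, sig g v = key.2 v].
have ex_base key : exists y, forall g, W key g -> W key y.
  case: (pselect (exists g, W key g)) => [[y Wy]|none]; first by exists y.
  by exists 1 => g Wg; case: none; exists g.
have {ex_base}[base baseP] := choice ex_base.
exists ((size F).+1 * (r.+1 * (lam + c0).+1) ^ #|Gamma| * (size S).+1)%N, #|Gamma|, c => n m.
pose M := (lam * n + c0)%N.
pose T : finType := ('I_(size F).+1 * {ffun Gamma -> 'I_r.+1 * 'I_M.+1} * 'I_(size S).+1)%type.
pose u p := p.1 * up (nth 1 F (i p)) * p.2.
pose pos p := index ((cj (base (u p, sig p.1)))^-1 * cj p.1) S.
pose code (p : G * G) : G * T := (u p, (inord (i p),
  [ffun v => (inord (sig p.1 v).1, inord (sig p.1 v).2)], inord (pos p))).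
pose b k := fset_set (rel_ball X H k).
pose pairs := [seq (g, h) | g <- b n, h <- b m].
have pairsP p : p \in pairs ->
    [/\ H p.1, H p.2, word_length X p.1 <= n & word_length X p.2 <= m].
  by move=> /allpairsP[[g h] /= [+ + ->]]; rewrite !mem_ball // => /asboolP[? ?] /asboolP[? ?].
have keyP p : p \in pairs -> [/\ i p < size F, W (u p, sig p.1) p.1 &
    (cj (base (u p, sig p.1)))^-1 * cj p.1 \in S].
  move=> /pairsP[H1 H2 _ _]; have [ip gp] := iP p H1 H2.
  have Wp : W (u p, sig p.1) p.1 by split.
  have [Hb gb sb] := baseP _ _ Wp; split=> //; apply: HS.
  apply: (Hgood _ _ (cj (u p))) => //; do ?exact: Kcj.
  by move=> v; have [] := sb v; split.
have sigP p v : p \in pairs -> (sig p.1 v).1 < r.+1 /\ (sig p.1 v).2 < M.+1.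
  move=> /pairsP[_ _ l1 _]; split; first by apply: leq_trans (lab_lt _ _) _.
  by rewrite ltnS; apply: ell_cj.
have code_inj : {in pairs &, injective code}.
  move=> p q pP qP [uE iE sE posE].
  have [ip [_ _ _] pS] := keyP p pP; have [iq _ qS] := keyP q qP.
  have {}iE : i p = i q.
    by have /(congr1 val) := iE; rewrite /= !inordK // ltnS ltnW.
  have {}sE : sig p.1 = sig q.1.
    apply/funext => v; move/ffunP/(_ v): sE; rewrite !ffunE => -[E1 E2].
    have [p1 p2] := sigP p v pP; have [q1 q2] := sigP q v qP.
    move/(congr1 val): E1; move/(congr1 val): E2; rewrite /= !inordK //.
    by rewrite /sig /= => -> ->.
  have {}posE : pos p = pos q.
    have /(congr1 val) := posE; rewrite /= !inordK // ltnS /pos ltnW // index_mem //.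
  have E1 : p.1 = q.1.
    have : cj p.1 = cj q.1.
      apply: (@mulgI _ (cj (base (u p, sig p.1)))^-1).
      rewrite -[LHS](nth_index 1 pS) -/(pos p) posE /pos uE sE nth_index //.
    by rewrite /cj => /mulIg/mulgI.
  have E2 : p.2 = q.2.
    have : u p = u q by [].
    by rewrite /u E1 iE => /mulgI.
  by rewrite [p]surjective_pairing [q]surjective_pairing E1 E2.
have szp : size pairs = (rel_growth X H n * rel_growth X H m)%N.
  by rewrite size_allpairs.
have up_pairs : uniq pairs.
  by apply: allpairs_uniq; rewrite ?fset_uniq // => -[? ?] [? ?].
have : size [seq code p | p <- pairs] <= size [seq (g, y) | g <- b (n + m + c), y <- enum T].
  apply: uniq_leq_size; first by rewrite map_inj_in_uniq.
  move=> _ /mapP[p pP ->]; apply/allpairsP; exists (code p) => /=.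
  rewrite mem_enum; split=> //; have [H1 H2 l1 l2] := pairsP p pP.
  have [ip _ _] := keyP p pP.
  rewrite mem_ball //; apply/asboolP; split.
    rewrite /u; apply: subgroupM => //; apply: subgroupM => //.
    exact: (KF _ (mem_nth _ ip)).
  rewrite (leq_trans (word_lengthM _ _ _)) // addnAC leq_add //.
  rewrite (leq_trans (word_lengthM _ _ _)) // leq_add //.
  by rewrite /c (big_rem (nth 1 F (i p))) ?mem_nth //= leq_addr.
rewrite size_map szp size_allpairs -cardT => /leq_trans; apply.
rewrite mulnC leq_mul2r; apply/orP; right.
rewrite !card_prod !card_ord card_ffun card_prod !card_ord.
have le : (r.+1 * M.+1) ^ #|Gamma| <=
    (r.+1 * (lam + c0).+1) ^ #|Gamma| * n.+1 ^ #|Gamma|.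
  rewrite -expnMn; case: (posnP #|Gamma|) => [-> //|k0].
  by rewrite leq_exp2r // -mulnA leq_mul2l /M; nia.
apply: leq_trans (leq_mul (leq_mul (leqnn _) le) (leqnn _)) _.
by rewrite mulnA [X in _ <= X]mulnAC.
Qed.

End Counting.

Theorem theorem1p5 (R : realType) (Gamma : sgraph) (H : set (raag Gamma)) :
  is_subgroup H -> finitely_generated H ->
  forall X : {fset raag Gamma}, generating X ->
    rel_growth_rate_exists R X H.
Proof.
move=> sH fgH X genX.
have [A [D [c super]]] := rel_growth_supermul genX sH fgH.
apply: (@growth_rate_exists R _ A D c (2 * size X).+1) super.
- by move=> n; apply: rel_growth_gt0 => //; apply: subgroup1.
- exact: rel_growth_homo.
- exact: rel_growth_expn.
Qed.
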